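(* Let $\eta^{ij}$ be a nondegenerate symmetric constant $N\times N$ matrix and let $\Phi(u)$, $u=(u^1,\dots,u^N)$, be any solution of the equations of associativity $$\sum_{m=1}^N\sum_{n=1}^N\eta^{mn}\frac{\partial^3\Phi}{\partial u^i\partial u^j\partial u^m}\frac{\partial^3\Phi}{\partial u^n\partial u^k\partial u^l}=\sum_{m=1}^N\sum_{n=1}^N\eta^{mn}\frac{\partial^3\Phi}{\partial u^i\partial u^k\partial u^m}\frac{\partial^3\Phi}{\partial u^n\partial u^j\partial u^l},\qquad 1\le i,j,k,l\le N.$$ Then $$L^{ij}=\eta^{ij}\frac{d}{dx}+\sum_{m=1}^N\sum_{n=1}^N\eta^{mn}\eta^{ip}\eta^{jr}\frac{\partial^3\Phi}{\partial u^p\partial u^m\partial u^k}u^k_x\left(\frac{d}{dx}\right)^{-1}\circ\frac{\partial^3\Phi}{\partial u^r\partial u^n\partial u^s}u^s_x$$ is a nonlocal Hamiltonian operator of hydrodynamic type with a flat metric, and moreover $$L^{ij}_{\lambda_1,\lambda_2}=\lambda_1\eta^{ij}\frac{d}{dx}+\lambda_2\sum_{m=1}^N\sum_{n=1}^N\eta^{mn}\eta^{ip}\eta^{jr}\frac{\partial^3\Phi}{\partial u^p\partial u^m\partial u^k}u^k_x\left(\frac{d}{dx}\right)^{-1}\circ\frac{\partial^3\Phi}{\partial u^r\partial u^n\partial u^s}u^s_x$$ is a pencil of compatible Hamiltonian operators ($\lambda_1,\lambda_2$ arbitrary constants). In particular, the operator $L^{ij}_{0,1}$ is a Hamiltonian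 operator compatible with the constant Hamiltonian operator $L^{ij}_{1,0}=\eta^{ij}\frac{d}{dx}$.
   Context: Here $u^i(x)$ are fields depending on one variable $x$, and repeated upper/lower indices are summed from $1$ to $N$. An operator $P^{ij}$ is Hamiltonian if the bracket $\{I,J\}=\int \frac{\delta I}{\delta u^i(x)}P^{ij}\frac{\delta J}{\delta u^j(x)}dx$ on functionals of the fields is skew-symmetric and satisfies the Jacobi identity. Two Hamiltonian operators are compatible if any linear combination of them with constant coefficients is Hamiltonian. The paper works with the following known criterion (Ferapontov): an operator $P^{ij} = g^{ij}(u) \frac{d}{dx} + b^{ij}_k (u)u^k_x + \sum_{m,n=1}^L \mu^{mn} (w_m)^i_k (u) u^k_x (\frac{d}{dx})^{-1} \circ (w_n)^j_s (u) u^s_x$ with nondegenerate $g^{ij}$ and nondegenerate symmetric constant $\mu^{mn}$ (a nonlocal operator of hydrodynamic type with metric $g^{ij}$) is Hamiltonian if and only if $g^{ij}=g^{ji}$ and 1) $b^{ij}_k=-g^{is}\Gamma^j_{sk}$, where $\Gamma^j_{sk}$ is the Levi-Civita connection of $g^{ij}$; 2) $g^{ik}(w_n)^j_k=g^{jk}(w_n)^i_k$; 3) $\nabla_k(w_n)^i_j=\nabla_j(w_n)^i_k$; 4) $g^{is}R^j_{skl}=\sum_{m,n=1}^L\mu^{mn}\left((w_m)^i_l(w_n)^j_k-(w_m)^j_l(w_n)^i_k\right)$, where $R^j_{skl}$ is the Riemannian curvature tensor; 5) $(w_n)^i_s(w_m)^s_j=(w_m)^i_s(w_n)^s_j$. 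*)

(* Defs.v *)
From HB Require Import structures.
From mathcomp Require Import all_boot all_order all_algebra.
From mathcomp Require Import all_classical all_reals all_analysis.

Set Implicit Arguments.
Unset Strict Implicit.
Unset Printing Implicit Defensive.
Import Order.TTheory GRing.Theory Num.Theory.
Import numFieldNormedType.Exports.
Local Open Scope classical_set_scope.
Local Open Scope ring_scope.

Section Smooth.
Context {R : realType}.

Fixpoint is_Ck {V W : normedModType R} (n : nat) (A : set V) (f : V -> W)
    : Prop :=
  match n with
  | 0%N => forall x, A x -> {for x, continuous f}
  | n'.+1 => (forall x, A x -> differentiable f x) /\
             (forall v, is_Ck n' A (fun x => 'D_v f x))
  end.

(* Only meant for open A. *)
Definition smooth_on {V W : normedModType R} (A : set V) (f : V -> W) : Prop :=
  forall n, is_Ck n A f.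

Definition partial {N} (i : 'I_N) (f : 'rV[R]_N -> R) : 'rV[R]_N -> R :=
  fun u => 'D_(delta_mx 0 i) f u.

Definition partial3 {N} (f : 'rV[R]_N -> R) (i j k : 'I_N) : 'rV[R]_N -> R :=
  partial i (partial j (partial k f)).

End Smooth.

(* The phase space consists of the smooth U-valued fields on the line that are
   equal to a background value a outside a compact set.  Covectors (values of
   variational derivatives) are smooth and equal to one and the same constant
   near -oo and near +oo; thus the functionals \int (h(u) - h(a)) dx are
   covered. *)
Section Functionals.
Context {R : realType} {N : nat}.
Implicit Types (U : set 'rV[R]_N) (a : 'rV[R]_N).

Definition const_beyond (f : R -> 'rV[R]_N) (M : R) (c : 'rV[R]_N) : Prop :=
  forall x, M <= `|x| -> f x = c.

Definition is_field U a (u : R -> 'rV[R]_N) : Prop :=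
  [/\ smooth_on setT u, (forall x, U (u x)) & exists M, const_beyond u M a].

Definition is_covector (xi : R -> 'rV[R]_N) : Prop :=
  smooth_on setT xi /\ exists M c, const_beyond xi M c.

(* Smooth finite-dimensional families of fields. *)
Definition is_family U a (k : nat) (O : set 'rV[R]_k)
    (u : 'rV[R]_k -> R -> 'rV[R]_N) : Prop :=
  [/\ open O,
      smooth_on (O `*` setT) (fun p : 'rV[R]_k * R => u p.1 p.2),
      (forall s x, O s -> U (u s x)) &
      forall s, O s -> exists M, \forall t \near s, const_beyond (u t) M a].

Definition pairing (xi v : R -> 'rV[R]_N) : R :=
  \int[lebesgue_measure]_(x in [set: R]) (\sum_(i < N) xi x 0 i * v x 0 i).

(* Smooth functionals on the fields, in the sense of smoothness along
   finite-dimensional families.  [vder I u] is the variational derivative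
   delta I / delta u; it is determined by [val I] at every field. *)
Record functional U a := Functional {
  val : (R -> 'rV[R]_N) -> R ;
  vder : (R -> 'rV[R]_N) -> R -> 'rV[R]_N ;
  vder_smooth : forall k (O : set 'rV[R]_k) u, is_family U a O u ->
    smooth_on (O `*` setT) (fun p : 'rV[R]_k * R => vder (u p.1) p.2) ;
  vder_const : forall k (O : set 'rV[R]_k) u, is_family U a O u ->
    forall s, O s -> exists M, \forall t \near s,
      exists c, const_beyond (vder (u t)) M c ;
  vderP : forall k (O : set 'rV[R]_k) u, is_family U a O u ->
    forall s e, O s ->
      is_derive s e (fun t => val (u t))
        (pairing (vder (u s)) (fun x => 'D_e (fun t => u t x) s))
}.

(* An operator P^{ij} sends a field u and a covector xi to the vector
   P^{ij} xi_j along u. *)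
Definition operator := (R -> 'rV[R]_N) -> (R -> 'rV[R]_N) -> R -> 'rV[R]_N.

Definition lin_comb (alpha beta : R) (P Q : operator) : operator :=
  fun u xi x => alpha *: P u xi x + beta *: Q u xi x.

Definition bracket U a (P : operator) (I J : functional U a)
    (u : R -> 'rV[R]_N) : R :=
  pairing (vder I u) (P u (vder J u)).

Definition represents U a (P : operator) (F I J : functional U a) : Prop :=
  forall u, is_field U a u -> val F u = bracket P I J u.

(* The Jacobi identity includes the fact that the brackets of functionals are
   again functionals. *)
Definition hamiltonian U (P : operator) : Prop :=
  forall a, U a ->
    (forall (I J : functional U a) u, is_field U a u ->
       bracket P I J u = - bracket P J I u) /\
    (forall I J K : functional U a, exists IJ JK KI : functional U a,
       [/\ represents P IJ I J, represents P JK J K, represents P KI K I &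
         forall u, is_field U a u ->
           bracket P IJ K u + bracket P JK I u + bracket P KI J u = 0]).

Definition compatible U (P Q : operator) : Prop :=
  [/\ hamiltonian U P, hamiltonian U Q &
      forall alpha beta : R, hamiltonian U (lin_comb alpha beta P Q)].

End Functionals.

Arguments operator : clear implicits.

Section Hydrodynamic.
Context {R : realType} {N : nat}.
Implicit Types (U : set 'rV[R]_N) (g : 'rV[R]_N -> 'M[R]_N).

(* The skew-symmetric inverse of d/dx. *)
Definition dx_inv (f : R -> R) (x : R) : R :=
  2^-1 * (\int[lebesgue_measure]_(y in `]-oo, x]) f y
          - \int[lebesgue_measure]_(y in `[x, +oo[) f y).

(* (w m u) i k is the coefficient (w_m)^i_k (u); b u i j k is b^{ij}_k (u). *)
Definition hydro_op g (b : 'rV[R]_N -> 'I_N -> 'I_N -> 'I_N -> R)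
    (L : nat) (mu : 'M[R]_L) (w : 'I_L -> 'rV[R]_N -> 'M[R]_N)
    : operator R N :=
  fun u xi x => \row_i \sum_(j < N)
    (g (u x) i j * derive1 xi x 0 j
     + (\sum_(k < N) b (u x) i j k * derive1 u x 0 k) * xi x 0 j
     + \sum_(m < L) \sum_(n < L)
         mu m n * (\sum_(k < N) w m (u x) i k * derive1 u x 0 k)
         * dx_inv (fun y => (\sum_(s < N) w n (u y) j s * derive1 u y 0 s)
                            * xi y 0 j) x).

Definition hydrodynamic_type U g (P : operator R N) : Prop :=
  exists (b : 'rV[R]_N -> 'I_N -> 'I_N -> 'I_N -> R) (L : nat)
         (mu : 'M[R]_L) (w : 'I_L -> 'rV[R]_N -> 'M[R]_N),
    [/\ (forall i j, smooth_on U (fun u => g u i j : R)) /\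
          (forall u, U u -> g u \in unitmx),
        (forall i j k, smooth_on U (fun u => b u i j k : R)),
        (forall n i j, smooth_on U (fun u => w n u i j : R)),
        mu^T = mu /\ mu \in unitmx &
        forall a u xi x, U a -> is_field U a u -> is_covector xi ->
          P u xi x = hydro_op g b mu w u xi x].

(* g is the contravariant metric g^{ij}, so that invmx (g u) is g_{ij}. *)
Definition christoffel g (j s k : 'I_N) (u : 'rV[R]_N) : R :=
  2^-1 * \sum_(l < N) g u j l *
    (partial s (fun v => invmx (g v) l k) u
     + partial k (fun v => invmx (g v) l s) u
     - partial l (fun v => invmx (g v) s k) u).

Definition riemann g (j s k l : 'I_N) (u : 'rV[R]_N) : R :=
  partial k (christoffel g j l s) u - partial l (christoffel g j k s) u
  + \sum_(p < N) (christoffel g j k p u * christoffel g p l s u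
                  - christoffel g j l p u * christoffel g p k s u).

Definition flat_metric U g : Prop :=
  (forall u, U u -> (g u)^T = g u /\ g u \in unitmx) /\
  (forall u, U u -> forall j s k l, riemann g j s k l u = 0).

End Hydrodynamic.

Section Associativity.
Context {R : realType} {N : nat}.
Implicit Types (eta : 'M[R]_N) (Phi : 'rV[R]_N -> R).

Definition associativity (U : set 'rV[R]_N) eta Phi : Prop :=
  forall u, U u -> forall i j k l : 'I_N,
    \sum_(m < N) \sum_(n < N)
      eta m n * partial3 Phi i j m u * partial3 Phi n k l u =
    \sum_(m < N) \sum_(n < N)
      eta m n * partial3 Phi i k m u * partial3 Phi n j l u.

Definition const_op eta : operator R N :=
  fun u xi x => \row_i \sum_(j < N) eta i j * derive1 xi x 0 j.

Definition nonlocal_op eta Phi : operator R N :=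
  fun u xi x => \row_i \sum_(j < N)
    \sum_(m < N) \sum_(n < N) \sum_(p < N) \sum_(r < N)
    \sum_(k < N) \sum_(s < N)
      eta m n * eta i p * eta j r
      * (partial3 Phi p m k (u x) * derive1 u x 0 k)
      * dx_inv (fun y => partial3 Phi r n s (u y) * derive1 u y 0 s * xi y 0 j) x.

Definition L_op eta Phi : operator R N :=
  fun u xi x => const_op eta u xi x + nonlocal_op eta Phi u xi x.

Definition L_pencil eta Phi (lambda1 lambda2 : R) : operator R N :=
  lin_comb lambda1 lambda2 (const_op eta) (nonlocal_op eta Phi).

End Associativity.

(* Main.v *)
Require Import Defs.
From HB Require Import structures.
From mathcomp Require Import all_boot all_order all_algebra.
From mathcomp Require Import all_classical all_reals all_analysis.
From mathcomp Require Import ring lra.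

Set Implicit Arguments.
Unset Strict Implicit.
Unset Printing Implicit Defensive.
Import Order.TTheory GRing.Theory Num.Theory.
Import numFieldNormedType.Exports.
Local Open Scope classical_set_scope.
Local Open Scope ring_scope.

(* Write M(y) for the matrix of third derivatives of Phi contracted with y, so that
   the derivative of the Hessian of Phi along a field u is A = M(u_x), and put
   q(xi) = dx_inv(xi eta A) eta; the pencil is
   xi |-> lambda1 xi_x eta + lambda2 q(xi) A eta.  Associativity says
   M(x) eta M(y) = M(y) eta M(x), and x M(y) = y M(x) by symmetry of third
   derivatives.

   Along a smooth family of fields, the derivative of {I,J} is computed by
   differentiating under the integral and integrating by parts.  The second
   variation of a functional is symmetric because mixed partial derivatives of its
   values on two-parameter families commute.  So {I,J} has the variational
   derivative
     I''(P dJ) - J''(P dI) + lambda2 (b_x M(q(dI)) - a_x M(q(dJ))),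
   where a = dI eta and b = dJ eta.  In the Jacobi identity the second variations
   cancel by their symmetry, and the cyclic sum of the remaining terms vanishes
   pointwise: the coefficient of lambda1 lambda2 by the symmetry of (x M(q), y) in
   x and y, that of lambda2^2 by associativity. *)

(** * Directional derivatives and smoothness *)

(** Covectors and potentials do not vanish at infinity, yet the integrations by parts leave no
    boundary terms. Covectors have equal limits at the two ends of the line, while values of the
    skew-symmetric [dx_inv] have opposite limits, so each product that arises either has equal
    limits at both ends or vanishes there. The Jacobi identity asks that brackets be functionals
    again, with a variational derivative that is smooth along every family of fields. Hence the
    analysis is done over finite-dimensional families whose supports in x are bounded locally
    uniformly in the parameters; a single field is the case of zero parameters. A functional does
    not come with a second variation. It is produced by adding one parameter that moves the fields
    in a given direction. That direction must vanish near both ends, as the values of the pencil do,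
    and a compactness argument keeps the enlarged family inside U. *)

Section DirectionalDerivatives.
Context {R : realType}.

(** A directional derivative sees only the values along one line. This allows passing between
    functions on different spaces: a family, its slices, and its extension by one more parameter. *)
Lemma derive_line {V V' W : normedModType R} (f : V -> W) (g : V' -> W) x v y w :
  (forall h : R, g (h *: w + y) = f (h *: v + x)) -> 'D_w g y = 'D_v f x.
Proof.
move=> gf; rewrite /derive.
suff -> : (fun h : R => h^-1 *: ((g \o shift y) (h *: w) - g y)) =
  (fun h : R => h^-1 *: ((f \o shift x) (h *: v) - f x)) by [].
apply/funext => h /=.
by rewrite gf; have := gf 0; rewrite !scale0r !add0r => ->.
Qed.

Lemma derivable_line {V V' W : normedModType R} (f : V -> W) (g : V' -> W) x v y w :
  (forall h : R, g (h *: w + y) = f (h *: v + x)) ->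
  derivable f x v -> derivable g y w.
Proof.
move=> gf; rewrite /derivable.
suff -> : (fun h : R => h^-1 *: ((g \o shift y) (h *: w) - g y)) =
  (fun h : R => h^-1 *: ((f \o shift x) (h *: v) - f x)) by [].
apply/funext => h /=.
by rewrite gf; have := gf 0; rewrite !scale0r !add0r => ->.
Qed.

(** Localising the intermediate point only by the absolute value of [h] covers both signs of [h] and
    [h = 0] in one statement. *)
Lemma mvt_line {V : normedModType R} (f : V -> R) x v (h : R) :
  (forall t : R, `|t| <= `|h| -> derivable f (x + t *: v) v) ->
  exists2 t : R, `|t| <= `|h| & f (x + h *: v) - f x = h * 'D_v f (x + t *: v).
Proof.
move=> df.
pose g (t : R) := f (x + t *: v).
have gline (t s : R) : g (s *: 1 + t) = f (s *: v + (x + t *: v)).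
  by rewrite /g -[s%:A]/(s * 1) mulr1 scalerDl addrCA.
have dg (t : R) : `|t| <= `|h| -> is_derive t 1 g ('D_v f (x + t *: v)).
  move=> th; apply: DeriveDef.
    by apply: derivable_line (df t th); exact: gline.
  by apply: derive_line; exact: gline.
have f0 : f x = g 0 by rewrite /g scale0r addr0.
rewrite f0 -/(g h); case: (ltgtP h 0) => [h0|h0|->]; last first.
- by exists 0; rewrite ?normr0// subrr mul0r.
- have [t|t|t tI ->] := @MVT _ g (fun t => 'D_v f (x + t *: v)) 0 h h0.
  + rewrite in_itv/= => /andP[t0 th]; apply: dg.
    by rewrite !gtr0_norm// ltW.
  + apply: (@derivable_within_continuous _ _ g `[0, h]) => {}t.
    rewrite in_itv/= => /andP[t0 th].
    by have [] := dg t; rewrite ?ger0_norm// (le_trans t0).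
  + move: tI; rewrite in_itv/= => /andP[t0 th].
    by exists t; rewrite ?gtr0_norm ?ltW// subr0 mulrC.
- have [t|t|t tI E] := @MVT _ g (fun t => 'D_v f (x + t *: v)) h 0 h0.
  + rewrite in_itv/= => /andP[t0 th]; apply: dg.
    by rewrite !ltr0_norm// lerN2 ltW.
  + apply: (@derivable_within_continuous _ _ g `[h, 0]) => {}t.
    rewrite in_itv/= => /andP[t0 th].
    by have [] := dg t; rewrite ?ler0_norm ?lerN2// (le_trans t0).
  + move: tI; rewrite in_itv/= => /andP[t0 th].
    exists t; first by rewrite !ltr0_norm// lerN2 ltW.
    by rewrite -[LHS]opprB E sub0r mulrN opprK mulrC.
Qed.

(* The expression is symmetric in v and w up to reordering, hence derive_commute. *)
Lemma second_difference {V : normedModType R} (f : V -> R) x v w (h : R) :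
  (forall s t : R, `|s| <= `|h| -> `|t| <= `|h| ->
     derivable f (x + s *: v + t *: w) v /\
     derivable ('D_v f) (x + s *: v + t *: w) w) ->
  exists s t : R, [/\ `|s| <= `|h|, `|t| <= `|h| &
    f (x + h *: v + h *: w) - f (x + h *: v) - (f (x + h *: w) - f x) =
    h * (h * 'D_w ('D_v f) (x + s *: v + t *: w))].
Proof.
move=> df.
pose g y := f (y + h *: w) - f y.
have dfh s : `|s| <= `|h| -> derivable (fun y => f (y + h *: w)) (x + s *: v) v.
  move=> sh; have [+ _] := df s h sh (lexx _).
  by apply: derivable_line => k; rewrite -[in LHS]addrA.
have df0 s : `|s| <= `|h| -> derivable f (x + s *: v) v.
  move=> sh; have := (df s 0 sh); rewrite normr0 normr_ge0 => /(_ isT)[+ _].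
  by rewrite scale0r addr0.
have [s sh sE] := @mvt_line _ g x v h (fun s sh => derivableB (dfh s sh) (df0 s sh)).
have [t th tE] := @mvt_line _ ('D_v f) (x + s *: v) w h
  (fun t th => (df s t sh th).2).
exists s, t; split => //; rewrite -tE.
transitivity (g (x + h *: v) - g x); first by rewrite /g.
rewrite sE; congr (_ * _).
rewrite [LHS](deriveB (dfh s sh) (df0 s sh)); congr (_ - _).
by apply: derive_line => k; rewrite -[in LHS]addrA.
Qed.

Lemma derive_commute {V : normedModType R} (A : set V) (f : V -> R) x v w :
  open A -> A x ->
  (forall y, A y -> derivable f y v /\ derivable f y w) ->
  (forall y, A y -> derivable ('D_v f) y w /\ derivable ('D_w f) y v) ->
  {for x, continuous ('D_w ('D_v f))} -> {for x, continuous ('D_v ('D_w f))} ->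
  'D_w ('D_v f) x = 'D_v ('D_w f) x.
Proof.
move=> oA Ax df ddf cwv cvw.
apply/eqP; rewrite -subr_eq0 -normr_le0; apply/ler_addgt0Pl => e e0.
rewrite addr0.
have e20 : 0 < e / 2 by rewrite divr_gt0.
have /cvgrPdist_le/(_ _ e20) cwv' := cwv.
have /cvgrPdist_le/(_ _ e20) cvw' := cvw.
have nA : \forall y \near x, A y by exact: open_nbhs_nbhs.
have /nbhs_ballP[d /= d0 dP] :
  \forall y \near x, [/\ A y, `|'D_w ('D_v f) x - 'D_w ('D_v f) y| <= e / 2
    & `|'D_v ('D_w f) x - 'D_v ('D_w f) y| <= e / 2].
  apply: filterS (filterI nA (filterI cwv' cvw')) => y [Ay [b1 b2]].
  split; [exact: Ay|exact: b1|exact: b2].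
(* With this [K] and [h = d / K / 2], all points of the parallelogram with sides [h *: v] and
   [h *: w] lie in the ball of radius [d]; the summand 1 makes [K] positive. *)
pose K := `|v| + `|w| + 1.
have K0 : 0 < K by rewrite /K ltr_wpDl.
pose h := d / K / 2.
have h0 : 0 < h by rewrite !divr_gt0.
have ballP : forall s t : R, `|s| <= `|h| -> `|t| <= `|h| ->
    ball x d (x + s *: v + t *: w).
  move=> s t sh th; rewrite -ball_normE /= -addrA opprD addNKr normrN.
  rewrite (le_lt_trans (ler_normD _ _))// !normrZ.
  rewrite (@le_lt_trans _ _ (h * K))//; last first.
    by rewrite /h mulrAC divfK ?gt_eqF// ltr_pdivrMr// ltr_pMr// ltr1n.
  rewrite (gtr0_norm h0) in sh th.
  rewrite /K !mulrDr mulr1 -[leLHS]addr0.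
  by apply: lerD; [apply: lerD; exact: ler_wpM2r|exact: ltW].
move: h h0 ballP => {}h h0 ballP.
have [s [t [sh th st]]] : exists s t : R, [/\ `|s| <= `|h|, `|t| <= `|h| &
    f (x + h *: v + h *: w) - f (x + h *: v) - (f (x + h *: w) - f x) =
    h * (h * 'D_w ('D_v f) (x + s *: v + t *: w))].
  apply: second_difference => s t sh th.
  have [Ay _ _] := dP _ (ballP s t sh th).
  by split; [exact: (df _ Ay).1|exact: (ddf _ Ay).1].
have [t' [s' [th' sh' ts]]] : exists s t : R, [/\ `|s| <= `|h|, `|t| <= `|h| &
    f (x + h *: w + h *: v) - f (x + h *: w) - (f (x + h *: v) - f x) =
    h * (h * 'D_v ('D_w f) (x + s *: w + t *: v))].
  apply: second_difference => t' s' th' sh'.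
  have [] := dP _ (ballP s' t' sh' th'); rewrite addrAC => Ay _ _.
  by split; [exact: (df _ Ay).2|exact: (ddf _ Ay).2].
have : h * (h * 'D_w ('D_v f) (x + s *: v + t *: w)) =
       h * (h * 'D_v ('D_w f) (x + s' *: v + t' *: w)).
  apply: (etrans (esym st)); rewrite (addrAC x) in ts.
  rewrite (addrAC x (s' *: v)); apply: etrans ts.
  have swap (a b c d' : R) : a - b - (c - d') = a - c - (b - d') by ring.
  exact: swap.
move/(mulfI (lt0r_neq0 h0))/(mulfI (lt0r_neq0 h0)) => E.
have [_ b1 _] := dP _ (ballP s t sh th).
have [_ _ b2] := dP _ (ballP s' t' sh' th').
apply: (le_trans (ler_distD ('D_w ('D_v f) (x + s *: v + t *: w)) _ _)).
by rewrite [leRHS]splitr; apply: lerD; [exact: b1|rewrite E distrC; exact: b2].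
Unshelve. all: by end_near. Qed.

(** The candidate differential is a bare function, so that it can be supplied as a formula; it is
    packed into a linear map inside the proof. *)
Lemma differentiable_linear_approx {V W : normedModType R} (f L : V -> W) x :
  linear L -> continuous L ->
  (forall e, 0 < e -> \forall h \near (0 : V), `|f (h + x) - f x - L h| <= e * `|h|) ->
  differentiable f x.
Proof.
move=> linL cL fL.
pose LM := GRing.isLinear.Build _ _ _ _ L linL.
pose L' : {linear V -> W} := HB.pack L LM.
have fE : f \o shift x = cst (f x) + L' +o_ 0 id.
  apply/eqaddoP => e e0; near=> h; rewrite opprD addrA /=.
  rewrite -[leLHS]/(`|f (h + x) - f x - L h|).
  by near: h; exact: fL.
apply/diff_locallyP; have dE := diff_unique (cL : continuous L') fE.
by split; rewrite dE.
Unshelve. all: by end_near. Qed.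

(** Kept abstract because two spaces have to be covered: the parameter space and its product with
    the line. *)
Definition coordinates (V : normedModType R) d (e : 'I_d -> V) (c : 'I_d -> V -> R) :=
  [/\ forall i, linear (c i), forall i, continuous (c i) &
      forall h, h = \sum_i c i h *: e i].

(** The increment is split into steps along the coordinate directions, and the mean value theorem is
    applied to each step. *)
Lemma differentiable_coordinates {V : normedModType R} d (e : 'I_d -> V) c
    (f : V -> R) x :
  coordinates e c ->
  (forall i, \forall y \near x, derivable f y (e i)) ->
  (forall i, {for x, continuous ('D_(e i) f)}) ->
  differentiable f x.
Proof.
move=> [linc cc cE] df cdf.
apply: (@differentiable_linear_approx _ _ _ (fun h => \sum_i c i h * 'D_(e i) f x)).
- move=> a h k; rewrite scaler_sumr -big_split/=; apply: eq_bigr => i _.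
  by rewrite linc mulrDl; congr (_ + _); rewrite -mulrA.
- apply: continuous_big => [|i _]; first exact: add_continuous.
  by move=> h; apply: cvgMl; exact: cc.
move=> eps eps0.
have [K K0 KP] : exists2 K, 0 < K & forall i h, `|c i h| <= K * `|h|.
  have lip i : exists k, 0 < k /\ forall h, `|c i h| <= k * `|h|.
    pose LM := GRing.isLinear.Build _ _ _ _ (c i) (linc i).
    pose L' : {linear V -> R} := HB.pack (c i) LM.
    have [k k0 kP] := @linear_lipschitz _ _ _ L' (cc i).
    by exists k.
  have [k kP] := choice lip.
  exists (1 + \sum_i k i).
    by rewrite ltr_pwDl// sumr_ge0// => i _; rewrite ltW// (kP i).1.
  move=> i h; rewrite (le_trans ((kP i).2 h))// ler_wpM2r//.
  rewrite (bigD1 i)//= addrCA lerDl addr_ge0// sumr_ge0// => j _.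
  by rewrite ltW// (kP j).1.
(* The [d] steps have lengths at most [K] times the norm of [h], so their errors add up to at most
   [eps] times that norm; the summand 1 covers [d = 0]. *)
pose eps' := eps / (d%:R * K + 1).
have dK0 : 0 < d%:R * K + 1 by rewrite ltr_wpDl// mulr_ge0// ltW.
have eps'0 : 0 < eps' by rewrite divr_gt0.
have /nbhs_ballP[rho /= rho0 rhoP] : \forall y \near x, forall i,
    derivable f y (e i) /\ `|'D_(e i) f x - 'D_(e i) f y| <= eps'.
  apply: filter_forall => i; have /cvgrPdist_le/(_ _ eps'0) := cdf i.
  move=> cdfi; apply: filterS (filterI (df i) cdfi) => y [dy cy].
  by split; [exact: dy|exact: cy].
(* Induction on the list of coordinates already moved. The bound on the weighted sum keeps every
   intermediate point in the ball where the partial derivatives are controlled. *)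
have tele (a : 'I_d -> R) (r : seq 'I_d) : \sum_(i <- r) `|a i| * `|e i| < rho ->
    `|f (\sum_(i <- r) a i *: e i + x) - f x - \sum_(i <- r) a i * 'D_(e i) f x|
    <= eps' * \sum_(i <- r) `|a i|.
  elim: r => [|i r IH]; first by rewrite !big_nil add0r subrr subr0 normr0 mulr0.
  rewrite !big_cons => sr.
  have sr' : \sum_(i <- r) `|a i| * `|e i| < rho.
    by rewrite (le_lt_trans _ sr)// lerDr mulr_ge0.
  pose y := \sum_(i <- r) a i *: e i + x.
  have yb (t : R) : `|t| <= `|a i| -> ball x rho (y + t *: e i).
    move=> ti; rewrite -ball_normE /= /y -[(_ + x) + _]addrAC opprD addrCA addrN addr0.
    rewrite normrN (le_lt_trans (ler_normD _ _))//.
    rewrite (le_lt_trans _ sr)// addrC lerD ?normrZ ?ler_wpM2r//.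
    by rewrite (le_trans (ler_norm_sum _ _ _))// ler_sum// => j _; rewrite normrZ.
  have [t ti tE] := @mvt_line _ f y (e i) (a i) (fun t ti => (rhoP _ (yb t ti) i).1).
  have -> : a i *: e i + \sum_(j <- r) a j *: e j + x = y + a i *: e i.
    by rewrite /y -addrA addrC.
  have -> : f (y + a i *: e i) - f x - (a i * 'D_(e i) f x + \sum_(j <- r) a j * 'D_(e j) f x) =
    a i * ('D_(e i) f (y + t *: e i) - 'D_(e i) f x) +
    (f y - f x - \sum_(j <- r) a j * 'D_(e j) f x).
    by rewrite mulrBr -tE; ring.
  apply: (le_trans (ler_normD _ _)); rewrite [leRHS]mulrDr.
  apply: lerD; last exact: IH.
  rewrite normrM mulrC; apply: ler_wpM2r => //.
  by have [_ +] := rhoP _ (yb t ti) i; rewrite distrC.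
pose S := \sum_i `|e i|.
have S0 : 0 <= S by rewrite sumr_ge0.
have near0 : \forall h \near (0 : V), `|h| < rho / (K * S + 1).
  by apply: nbhs0_lt; rewrite divr_gt0// ltr_wpDl// mulr_ge0// ltW.
near=> h.
have hlt : `|h| < rho / (K * S + 1) by near: h.
have := tele (fun i => c i h) (index_enum 'I_d).
rewrite -cE => /(_ _)/le_trans; apply.
- rewrite (@le_lt_trans _ _ (`|h| * (K * S + 1)))//; last first.
    by rewrite -ltr_pdivlMr// ltr_wpDl// mulr_ge0// ltW.
  rewrite mulrDr mulr1 ler_wpDr// /S !mulr_sumr ler_sum// => i _.
  by rewrite mulrA [_ * K]mulrC ler_wpM2r.
- rewrite (@le_trans _ _ (eps' * (d%:R * K * `|h|)))//.
    rewrite ler_wpM2l ?(ltW eps'0)// -mulrA.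
    have -> : d%:R * (K * `|h|) = \sum_(i < d) (K * `|h|).
      by rewrite sumr_const card_ord mulr_natl.
    by rewrite ler_sum.
  rewrite mulrA ler_wpM2r// /eps' -mulrA ler_piMr ?(ltW eps0)//.
  by rewrite mulrC ler_pdivrMr// mul1r lerDl.
Unshelve. all: by end_near. Qed.

Lemma coordinates_rV k :
  coordinates (fun i => delta_mx 0 i : 'rV[R]_k) (fun i (h : 'rV[R]_k) => h 0 i).
Proof.
split => [i a h l|i h|h]; first by rewrite !mxE.
  exact: coord_continuous.
exact: row_sum_delta.
Qed.

Lemma coordinates_rVR k : coordinates
  (fun i : 'I_k.+1 => if unlift ord0 i is Some j then (delta_mx 0 j, 0) : 'rV[R]_k * R else (0, 1))
  (fun i (h : 'rV[R]_k * R) => if unlift ord0 i is Some j then h.1 0 j else h.2).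
Proof.
split => [i a h l|i h|h].
- by case: unliftP => [j|] _ //=; rewrite !mxE.
- case: unliftP => [j|] _ /=; last exact: cvg_snd.
  apply: (@continuous_comp _ _ _ fst (fun v : 'rV[R]_k => v 0 j)); first exact: cvg_fst.
  exact: coord_continuous.
- rewrite big_ord_recl unlift_none; under eq_bigr do rewrite liftK.
  rewrite [h in LHS]surjective_pairing [h.1 in LHS]row_sum_delta.
  rewrite (_ : \sum_i _ = (\sum_(i < k) h.1 0 i *: delta_mx 0 i, 0)).
    apply: injective_projections => /=.
      by rewrite scaler0 add0r.
    by rewrite addr0 -[RHS]/(h.2 * 1) mulr1.
  apply: injective_projections => /=.
    by rewrite (big_morph fst (fun _ _ => erefl) erefl).
  rewrite (big_morph snd (fun _ _ => erefl) erefl) big1// => i _ /=.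
  by rewrite scaler0.
Qed.

End DirectionalDerivatives.


(** * Calculus of smooth maps *)

Section Smoothness.
Context {R : realType}.
Implicit Types V W : normedModType R.

Lemma is_Ck_continuous V W n (A : set V) (f : V -> W) x :
  is_Ck n A f -> A x -> {for x, continuous f}.
Proof.
by case: n => [|n] /=; [exact|move=> [df _] Ax; exact/differentiable_continuous/df].
Qed.

Lemma is_CkW V W n (A : set V) (f : V -> W) : is_Ck n.+1 A f -> is_Ck n A f.
Proof.
elim: n f => [|n IH] f; first by move=> fS x; exact: is_Ck_continuous fS.
by move=> [df Df]; split => // v; exact/IH/Df.
Qed.

Lemma differentiable_eq V W (f g : V -> W) x :
  (\forall y \near x, f y = g y) -> differentiable f x -> differentiable g x.
Proof.
move=> fg df; apply: (@differentiable_linear_approx _ _ _ _ ('d f x)).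
- exact: linearP.
- exact: diff_continuous.
move=> e e0.
have /eqaddoP/(_ _ e0) := diff_locally df.
have : \forall h \near (0 : V), f (h + x) = g (h + x).
  by move: fg; rewrite (near_shift 0) /= subr0.
apply: filterS2 => h fgh; rewrite opprD addrA -[g x](nbhs_singleton fg) -fgh.
exact.
Qed.

Lemma is_Ck_eq V W n (A : set V) (f g : V -> W) : open A ->
  (forall x, A x -> f x = g x) -> is_Ck n A f -> is_Ck n A g.
Proof.
move=> oA; elim: n f g => [|n IH] f g fg.
  move=> cf x Ax; rewrite /prop_for /continuous_at -(fg x Ax).
  apply: cvg_trans (cf x Ax); apply: near_eq_cvg.
  by apply: filterS (open_nbhs_nbhs (conj oA Ax)) => y /fg.
move=> [df Df]; split.
  move=> x Ax; apply: differentiable_eq (df x Ax).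
  by apply: filterS (open_nbhs_nbhs (conj oA Ax)) => y /fg.
move=> v; apply: IH (Df v) => x Ax; apply: near_eq_derive.
by apply: filterS (open_nbhs_nbhs (conj oA Ax)) => y /fg.
Qed.

Lemma is_Ck_cst V W n (A : set V) (w : W) : is_Ck n A (fun=> w : W).
Proof.
elim: n w => [|n IH] w; first by move=> x _; exact: cvg_cst.
split => [x _|v]; first exact: differentiable_cst.
have -> : 'D_v (fun=> w : W) = (fun=> 0) :> (V -> W).
  by apply/funext => x; exact: derive_cst.
exact: IH.
Qed.

Lemma is_CkD V W n (A : set V) (f g : V -> W) : open A ->
  is_Ck n A f -> is_Ck n A g -> is_Ck n A (fun x => f x + g x).
Proof.
move=> oA; elim: n f g => [|n IH] f g.
  by move=> cf cg x Ax; apply: cvgD; [exact: cf|exact: cg].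
move=> [df Df] [dg Dg]; split.
  by move=> x Ax; apply: (differentiableD (df x Ax) (dg x Ax)).
move=> v; apply: is_Ck_eq (IH _ _ (Df v) (Dg v)) => // x Ax.
by rewrite -deriveD//; apply: diff_derivable; [exact: df|exact: dg].
Qed.

Lemma is_CkM V n (A : set V) (f g : V -> R) : open A ->
  is_Ck n A f -> is_Ck n A g -> is_Ck n A (fun x => f x * g x).
Proof.
move=> oA; elim: n f g => [|n IH] f g.
  by move=> cf cg x Ax; apply: cvgM; [exact: cf|exact: cg].
move=> Cf Cg; have [df Df] := Cf; have [dg Dg] := Cg; split.
  by move=> x Ax; apply: (differentiableM (df x Ax) (dg x Ax)).
move=> v.
apply: is_Ck_eq (is_CkD oA (IH _ _ (is_CkW Cf) (Dg v)) (IH _ _ (is_CkW Cg) (Df v))) => // x Ax.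
by rewrite [RHS]deriveM//; apply: diff_derivable; [exact: df|exact: dg].
Qed.

Lemma is_CkZl V W n (A : set V) (f : V -> R) (w : W) : open A ->
  is_Ck n A f -> is_Ck n A (fun x => f x *: w).
Proof.
move=> oA; elim: n f => [|n IH] f.
  by move=> cf x Ax; apply: cvgZr_tmp; exact: cf.
move=> [df Df]; split => [x Ax|v]; first exact: differentiableZl (df x Ax).
apply: is_Ck_eq (IH _ (Df v)) => // x Ax.
rewrite [RHS]deriveE; last exact: differentiableZl (df x Ax).
by rewrite diffZl ?deriveE//; exact: df.
Qed.

Lemma is_Ck_sum V W n (A : set V) (I : Type) (r : seq I) (f : I -> V -> W) :
  open A -> (forall i, is_Ck n A (f i)) -> is_Ck n A (fun x => \sum_(i <- r) f i x).
Proof.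
move=> oA fS; elim: r => [|i r IH].
  by apply: (is_Ck_eq oA _ (is_Ck_cst n A 0)) => x _; rewrite big_nil.
by apply: (is_Ck_eq oA _ (is_CkD oA (fS i) IH)) => x _; rewrite big_cons.
Qed.

Lemma is_Ck_postlin V W W' n (A : set V) (f : V -> W) (l : W -> W') : open A ->
  linear l -> continuous l -> is_Ck n A f -> is_Ck n A (fun x => l (f x)).
Proof.
move=> oA linl cl.
pose LM := GRing.isLinear.Build _ _ _ _ l linl.
pose l' : {linear W -> W'} := HB.pack l LM.
have dl y : differentiable l y by exact: (@linear_differentiable _ _ _ l').
elim: n f => [|n IH] f.
  by move=> cf x Ax; apply: (@continuous_comp _ _ _ f l); [exact: cf|exact: cl].
move=> [df Df]; split => [x Ax|v].
  exact: (differentiable_comp (df x Ax)).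
apply: is_Ck_eq (IH _ (Df v)) => // x Ax.
rewrite [RHS]deriveE; last exact: (differentiable_comp (df x Ax)).
rewrite -[fun x => l (f x)]/(l \o f) diff_comp//=; last exact: df.
by rewrite (@diff_lin _ _ _ l')// deriveE//; exact: df.
Qed.

Lemma is_Ck_prelin V V' W n (A : set V) (B : set V') (f : V -> W) (l : V' -> V) :
  linear l -> continuous l -> (forall x, B x -> A (l x)) ->
  is_Ck n A f -> is_Ck n B (fun x => f (l x)).
Proof.
move=> linl cl BA.
pose LM := GRing.isLinear.Build _ _ _ _ l linl.
pose l' : {linear V' -> V} := HB.pack l LM.
have dl y : differentiable l y by exact: (@linear_differentiable _ _ _ l').
elim: n f => [|n IH] f.
  move=> cf x Bx; apply: (@continuous_comp _ _ _ l f); first exact: cl.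
  exact/cf/BA.
move=> [df Df]; split => [x Bx|v]; first exact/differentiable_comp/df/BA.
have -> : 'D_v (fun x => f (l x)) = (fun x => 'D_(l v) f (l x)).
  by apply/funext => x; apply: derive_line => h; rewrite linl.
exact: IH ('D_(l v) f) (Df (l v)).
Qed.

Lemma derive_sum_coordinates V W d (e : 'I_d -> V) c (f : V -> W) x v :
  coordinates e c -> differentiable f x ->
  'D_v f x = \sum_i c i v *: 'D_(e i) f x.
Proof.
move=> [_ _ cE] df; rewrite deriveE// {1}[v]cE linear_sum/=.
by apply: eq_bigr => i _; rewrite linearZ/= deriveE.
Qed.

(** Continuity of the derivatives along [e] gives differentiability, after which every directional
    derivative is a fixed linear combination of them. Integrals with parameters are handled this
    way, their derivatives being computed direction by direction. *)
Lemma is_CkS_coordinates V d (e : 'I_d -> V) c n (A : set V) (f : V -> R) :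
  coordinates e c -> open A ->
  (forall i x, A x -> derivable f x (e i)) ->
  (forall i, is_Ck n A ('D_(e i) f)) -> is_Ck n.+1 A f.
Proof.
move=> ec oA df Df.
have dif x : A x -> differentiable f x.
  move=> Ax; apply: (differentiable_coordinates ec) => i.
    by apply: filterS (open_nbhs_nbhs (conj oA Ax)) => y; exact: df.
  exact: is_Ck_continuous (Df i) Ax.
split => // v.
have S : is_Ck n A (fun x => \sum_i c i v * 'D_(e i) f x).
  by apply: is_Ck_sum => // i; apply: is_CkM => //; exact: is_Ck_cst.
apply: is_Ck_eq S => // x Ax; rewrite (derive_sum_coordinates _ ec)//.
exact: dif.
Qed.

Lemma derive_comp_rV V W N (f : 'rV[R]_N -> W) (g : V -> 'rV[R]_N) x v :
  differentiable g x -> differentiable f (g x) ->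
  'D_v (fun y => f (g y)) x =
  \sum_k ('D_v g x) 0 k *: 'D_(delta_mx 0 k) f (g x).
Proof.
move=> dg df; rewrite deriveE; last exact: (differentiable_comp dg).
rewrite -[fun x => f (g x)]/(f \o g) diff_comp//= -deriveE//.
by rewrite (derive_sum_coordinates _ (coordinates_rV N))// -deriveE.
Qed.

(** Induction with [f] generalised and [g] fixed: the chain rule leads to composites of the partial
    derivatives of [f] with the same [g], one order lower. *)
Lemma is_Ck_comp_rV V N n (A : set V) (B : set 'rV[R]_N) (f : 'rV[R]_N -> R)
    (g : V -> 'rV[R]_N) : open A -> (forall x, A x -> B (g x)) ->
  is_Ck n A g -> is_Ck n B f -> is_Ck n A (fun x => f (g x)).
Proof.
move=> oA AB; elim: n f => [|n IH] f.
  move=> cg cf x Ax; apply: (@continuous_comp _ _ _ g f); first exact: cg.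
  exact/cf/AB.
move=> Cg [df Df]; have [dg Dg] := Cg; split => [x Ax|v].
  by apply: (differentiable_comp (dg x Ax)); exact/df/AB.
have S : is_Ck n A (fun x => \sum_k ('D_v g x) 0 k * 'D_(delta_mx 0 k) f (g x)).
  apply: is_Ck_sum => // k; apply: is_CkM => //.
    apply: (is_Ck_postlin (l := fun u : 'rV[R]_N => u 0 k)) (Dg v) => //.
      by move=> a p q; rewrite !mxE.
    exact: coord_continuous.
  exact: IH ('D_(delta_mx 0 k) f) (is_CkW Cg) (Df (delta_mx 0 k)).
apply: is_Ck_eq S => // x Ax; rewrite derive_comp_rV//; first exact: dg.
exact/df/AB.
Qed.

Lemma is_Ck_mx V m p n (A : set V) (f : V -> 'M[R]_(m, p)) : open A ->
  (forall i j, is_Ck n A (fun x => f x i j)) -> is_Ck n A f.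
Proof.
move=> oA fS.
have S : is_Ck n A (fun x => \sum_i \sum_j f x i j *: delta_mx i j : 'M[R]_(m, p)).
  by apply: is_Ck_sum => // i; apply: is_Ck_sum => // j; exact: is_CkZl.
by apply: is_Ck_eq S => // x _; rewrite -matrix_sum_delta.
Qed.

Section OpenDomain.
Context {V : normedModType R}.
Variables (A : set V) (oA : open A).

Lemma smooth_eq W (f g : V -> W) :
  (forall x, A x -> f x = g x) -> smooth_on A f -> smooth_on A g.
Proof. by move=> fg fS n; exact: is_Ck_eq fg (fS n). Qed.

Lemma smooth_cst W (w : W) : smooth_on A (fun=> w).
Proof. by move=> n; exact: is_Ck_cst. Qed.

Lemma smoothD W (f g : V -> W) :
  smooth_on A f -> smooth_on A g -> smooth_on A (fun x => f x + g x).
Proof. by move=> fS gS n; exact: is_CkD. Qed.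

Lemma smoothM (f g : V -> R) :
  smooth_on A f -> smooth_on A g -> smooth_on A (fun x => f x * g x).
Proof. by move=> fS gS n; exact: is_CkM. Qed.

Lemma smooth_sum W (I : Type) (r : seq I) (f : I -> V -> W) :
  (forall i, smooth_on A (f i)) -> smooth_on A (fun x => \sum_(i <- r) f i x).
Proof. by move=> fS n; apply: is_Ck_sum => // i; exact: fS. Qed.

Lemma smooth_mx m p (f : V -> 'M[R]_(m, p)) :
  (forall i j, smooth_on A (fun x => f x i j)) -> smooth_on A f.
Proof. by move=> fS n; apply: is_Ck_mx => // i j; exact: fS. Qed.

Lemma smooth_coord m p (f : V -> 'M[R]_(m, p)) i j :
  smooth_on A f -> smooth_on A (fun x => f x i j).
Proof.
move=> fS n; apply: (is_Ck_postlin (l := fun u : 'M[R]_(m, p) => u i j)) (fS n) => //.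
  by move=> a k q; rewrite !mxE.
exact: coord_continuous.
Qed.

Lemma smoothZ W (r : R) (f : V -> W) :
  smooth_on A f -> smooth_on A (fun x => r *: f x).
Proof.
move=> fS n; apply: (is_Ck_postlin (l := fun w : W => r *: w)) (fS n) => //.
  by move=> a p q; rewrite scalerDr !scalerA mulrC.
exact: scaler_continuous.
Qed.

Lemma smoothB W (f g : V -> W) :
  smooth_on A f -> smooth_on A g -> smooth_on A (fun x => f x - g x).
Proof.
move=> fS gS; apply: smooth_eq (smoothD fS (smoothZ (-1) gS)) => x _.
by rewrite scaleN1r.
Qed.

Lemma smooth_mulmx m p q (f : V -> 'M[R]_(m, p)) (g : V -> 'M[R]_(p, q)) :
  smooth_on A f -> smooth_on A g -> smooth_on A (fun x => f x *m g x).
Proof.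
move=> fS gS; apply: smooth_mx => i j.
have S : smooth_on A (fun x => \sum_k f x i k * g x k j).
  by apply: smooth_sum => k; apply: smoothM; exact: smooth_coord.
by apply: smooth_eq S => x _; rewrite mxE.
Qed.

Lemma smooth_comp_rV N (B : set 'rV[R]_N) (f : 'rV[R]_N -> R) (g : V -> 'rV[R]_N) :
  (forall x, A x -> B (g x)) -> smooth_on A g -> smooth_on B f ->
  smooth_on A (fun x => f (g x)).
Proof. by move=> AB gS fS n; exact: is_Ck_comp_rV AB (gS n) (fS n). Qed.

Lemma smooth_derive W (f : V -> W) v : smooth_on A f -> smooth_on A ('D_v f).
Proof. by move=> fS n; have [_] := fS n.+1; exact. Qed.

Lemma smooth_differentiable W (f : V -> W) x :
  smooth_on A f -> A x -> differentiable f x.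
Proof. by move=> fS; have [+ _] := fS 1%N; exact. Qed.

Lemma smooth_derivable W (f : V -> W) x v :
  smooth_on A f -> A x -> derivable f x v.
Proof. by move=> fS Ax; exact/diff_derivable/smooth_differentiable. Qed.

Lemma smooth_continuous W (f : V -> W) x :
  smooth_on A f -> A x -> {for x, continuous f}.
Proof. by move=> fS; exact: is_Ck_continuous (fS 0%N). Qed.

Lemma smooth_derive_commute (f : V -> R) x v w : smooth_on A f -> A x ->
  'D_w ('D_v f) x = 'D_v ('D_w f) x.
Proof.
move=> fS Ax; apply: (derive_commute oA Ax) => [y Ay|y Ay||].
- by split; exact: smooth_derivable.
- by split; exact: smooth_derivable (smooth_derive _ fS) Ay.
- exact: smooth_continuous (smooth_derive _ (smooth_derive _ fS)) Ax.
- exact: smooth_continuous (smooth_derive _ (smooth_derive _ fS)) Ax.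
Qed.

End OpenDomain.

Lemma smooth_prelin V V' W (A : set V) (B : set V') (f : V -> W) (l : V' -> V) :
  linear l -> continuous l -> (forall x, B x -> A (l x)) ->
  smooth_on A f -> smooth_on B (fun x => f (l x)).
Proof. by move=> ? ? ? fS n; exact: is_Ck_prelin (fS n). Qed.

Lemma derive_coord V m p (f : V -> 'M[R]_(m, p)) x v i j : derivable f x v ->
  'D_v (fun y => f y i j) x = 'D_v f x i j.
Proof. by move=> df; rewrite derive_mx// mxE. Qed.

Lemma derive_mulmx V m p q (f : V -> 'M[R]_(m, p)) (g : V -> 'M[R]_(p, q)) x v :
  derivable f x v -> derivable g x v ->
  'D_v (fun y => f y *m g y) x = 'D_v f x *m g x + f x *m 'D_v g x.
Proof.
move=> df dg.
have dfi i j := (derivable_mxP f x v).1 df i j.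
have dgi i j := (derivable_mxP g x v).1 dg i j.
have dfg i j k : derivable (fun y => f y i k * g y k j) x v.
  by apply: derivableM; [exact: dfi|exact: dgi].
have E i j : (fun y => (f y *m g y) i j) = \sum_k (fun y => f y i k * g y k j).
  by apply/funext => y; rewrite mxE fct_sumE.
have dm : derivable (fun y => f y *m g y) x v.
  by apply/derivable_mxP => i j; rewrite E; apply: derivable_sum.
apply/matrixP => i j; rewrite -derive_coord// E derive_sum//.
rewrite !mxE -big_split/=; apply: eq_bigr => k _.
rewrite -[fun y => _]/((fun y => f y i k) * (fun y => g y k j)) deriveM//.
by rewrite (derive_coord k j dg) (derive_coord i k df) addrC; congr (_ + _); exact: mulrC.
Qed.

Lemma smooth_derive_commute_mx V m p (A : set V) (f : V -> 'M[R]_(m, p)) x v w :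
  open A -> smooth_on A f -> A x -> 'D_w ('D_v f) x = 'D_v ('D_w f) x.
Proof.
move=> oA fS Ax; apply/matrixP => i j.
have E v' w' : ('D_w' ('D_v' f) x) i j = 'D_w' ('D_v' (fun y => f y i j)) x.
  rewrite -derive_coord; last exact: smooth_derivable (smooth_derive v' fS) Ax.
  apply: near_eq_derive; apply: filterS (open_nbhs_nbhs (conj oA Ax)) => y Ay.
  by rewrite derive_coord//; exact: smooth_derivable fS Ay.
apply: (etrans (E v w)); apply: (etrans _ (esym (E w v))).
exact: (smooth_derive_commute oA v w (smooth_coord oA i j fS) Ax).
Qed.

End Smoothness.


(** * Integration over the line and the skew-symmetric inverse of d/dx *)

Section LineIntegrals.
Context {R : realType}.
Notation mu := (@lebesgue_measure R).
Implicit Types (f g : R -> R) (D : set R).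

Definition zero_beyond (M : R) f := forall x, M <= `|x| -> f x = 0.

Definition cont_compact f := continuous f /\ exists M, zero_beyond M f.

Lemma zero_beyondW (M M' : R) f : M <= M' -> zero_beyond M f -> zero_beyond M' f.
Proof. by move=> MM' fM x /(le_trans MM'); exact: fM. Qed.

Lemma cont_compactD f g :
  cont_compact f -> cont_compact g -> cont_compact (fun x => f x + g x).
Proof.
move=> [cf [M fM]] [cg [M' gM]]; split.
  by move=> x; apply: cvgD; [exact: cf|exact: cg].
exists (Num.max M M') => x Mx.
by move: Mx; rewrite ge_max => /andP[/fM -> /gM ->]; rewrite addr0.
Qed.

Lemma cont_compactZ (r : R) f : cont_compact f -> cont_compact (fun x => r * f x).
Proof.
move=> [cf [M fM]]; split; first by move=> x; apply: cvgMr; exact: cf.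
by exists M => x /fM ->; rewrite mulr0.
Qed.

Lemma Rintegral_eq_support D D' f : D' `<=` D -> (forall x, D x -> ~ D' x -> f x = 0) ->
  \int[mu]_(x in D) f x = \int[mu]_(x in D') f x.
Proof.
move=> D'D fD; rewrite Rintegral_mkcond [RHS]Rintegral_mkcond.
apply: eq_Rintegral => x _; rewrite !patchE.
case: ifPn => [/set_mem Dx|/negP nDx]; case: ifPn => [/set_mem D'x|/negP nD'x] //.
  by apply: fD => // D'x; apply: nD'x; exact: mem_set.
by exfalso; apply: nDx; apply: mem_set; exact: D'D.
Qed.

Lemma cont_compact_integrable D f : measurable D -> cont_compact f ->
  mu.-integrable D (EFin \o f).
Proof.
move=> mD [cf [M fM]].
have int1 : mu.-integrable `[- M, M] (EFin \o f).
  apply: continuous_compact_integrable; first exact: segment_compact.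
  exact: continuous_subspaceT.
have : mu.-integrable setT (EFin \o f).
  move: int1; rewrite integrable_mkcond//; congr (integrable _ _ _).
  apply/funext => x; rewrite patchE; case: ifPn => // /negP nx /=.
  rewrite fM// leNgt; apply/negP => /ltW xM; apply: nx; apply: mem_set => /=.
  by rewrite in_itv/= -ler_norml.
by apply: integrableS.
Qed.

(** The bound is independent of [D]; estimates for half-lines are thus uniform in their endpoint. *)
Lemma Rintegral_bound D f (M K : R) : measurable D -> continuous f ->
  0 <= M -> zero_beyond M f -> (forall x, `|f x| <= K) ->
  `|\int[mu]_(x in D) f x| <= K * (2 * M).
Proof.
move=> mD cf M0 fM fK.
have K0 : 0 <= K by rewrite (le_trans _ (fK 0)).
have mI : measurable (D `&` `[- M, M]) by exact: measurableI.
have fint E : measurable E -> mu.-integrable E (EFin \o f).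
  by move=> mE; apply: cont_compact_integrable => //; split=> //; exists M.
rewrite (@Rintegral_eq_support D (D `&` `[- M, M]))//; last first.
  move=> x Dx nx; rewrite fM// leNgt; apply/negP => /ltW xM; apply: nx.
  by split => //=; rewrite in_itv/= -ler_norml.
pose J := D `&` `[- M, M].
rewrite -/J in mI *.
rewrite (le_trans (le_normr_Rintegral _ (fint _ _)))//.
have fin : (mu J <= (2 * M)%R%:E)%E.
  apply: (@le_trans _ _ (mu `[(- M)%R, M]%classic)).
    by apply: le_measure; rewrite ?inE//; exact: subIsetr.
  rewrite lebesgue_measure_itv/= lte_fin; case: ifPn => _.
    by rewrite -EFinB lee_fin opprK mulr2n mulrDl mul1r.
  by rewrite lee_fin mulr_ge0.
have finn : mu J \is a fin_num.
  by rewrite ge0_fin_numE// (le_lt_trans fin) ?ltry.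
apply: (@le_trans _ _ (\int[mu]_(x in J) K)).
  apply: le_Rintegral => //.
  - by have /(integrable_norm)  := fint _ mI.
  - apply/integrableP; split; first exact: measurable_cst.
    under eq_integral do rewrite /= ger0_norm//.
    rewrite integral_cst// lte_mul_pinfty ?lee_fin//.
    by rewrite (le_lt_trans fin) ?ltry.
rewrite Rintegral_cst// ler_wpM2l//.
by rewrite -lee_fin fineK.
Qed.

Lemma RintegralD_compact D f g : measurable D -> cont_compact f -> cont_compact g ->
  \int[mu]_(x in D) (f x + g x) = \int[mu]_(x in D) f x + \int[mu]_(x in D) g x.
Proof. by move=> mD cf cg; rewrite RintegralD//; exact: cont_compact_integrable. Qed.

Lemma RintegralZ_compact D f (r : R) : measurable D -> cont_compact f ->
  \int[mu]_(x in D) (r * f x) = r * \int[mu]_(x in D) f x.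
Proof. by move=> mD cf; rewrite RintegralZl//; exact: cont_compact_integrable. Qed.

(** The two half-line integrals add up to the total integral, so [dx_inv f] is the primitive from
    the left end lowered by half of the total. *)
Lemma dx_invE f x : cont_compact f ->
  dx_inv f x = \int[mu]_(y in `]-oo, x]) f y - 2^-1 * \int[mu]_y f y.
Proof.
move=> cf; rewrite /dx_inv.
have fi E : measurable E -> mu.-integrable E (EFin \o f).
  by move=> mE; exact: cont_compact_integrable.
have -> : \int[mu]_(y in `[x, +oo[) f y = \int[mu]_y f y - \int[mu]_(y in `]-oo, x]) f y.
  rewrite -Rintegral_itv_obnd_cbnd; last exact: fi.
  rewrite -set_itvNyy Rintegral_itvB//; exact: fi.
by field.
Qed.

Lemma is_derive_primitive f (x : R) : cont_compact f ->
  is_derive x 1 (fun x => \int[mu]_(y in `]-oo, x]) f y) (f x).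
Proof.
move=> cf.
(* The endpoint [x + 1] only has to lie to the right of [x]. *)
have [] := @continuous_FTC1 R f -oo%O x (x + 1) _ _ _ _.
- by rewrite ltrDl.
- exact: cont_compact_integrable.
- by rewrite ltNyr.
- by case: cf => + _; exact.
- by move=> d1 d2; apply: DeriveDef; [exact: d1|rewrite -d2 derive1E].
Qed.

Lemma is_derive_dx_inv f (x : R) : cont_compact f -> is_derive x 1 (dx_inv f) (f x).
Proof.
move=> cf; have -> : dx_inv f =
    (fun x => \int[mu]_(y in `]-oo, x]) f y) - cst (2^-1 * \int[mu]_y f y).
  by apply/funext => y; rewrite dx_invE.
have := is_derive_primitive x cf => dp.
by apply: is_derive_eq; rewrite subr0.
Qed.

Lemma dx_invD f g x : cont_compact f -> cont_compact g ->
  dx_inv (fun y => f y + g y) x = dx_inv f x + dx_inv g x.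
Proof.
move=> cf cg; rewrite !dx_invE//; last exact: cont_compactD.
by rewrite !RintegralD_compact//; ring.
Qed.

Lemma dx_invZ f (r : R) x : cont_compact f ->
  dx_inv (fun y => r * f y) x = r * dx_inv f x.
Proof.
move=> cf; rewrite !dx_invE//; last exact: cont_compactZ.
by rewrite !RintegralZ_compact//; ring.
Qed.

Lemma cont_compact0 : cont_compact (fun=> 0).
Proof. by split; [move=> x; exact: cvg_cst|exists 0]. Qed.

Lemma cont_compact_sum (I : Type) (r : seq I) (f : I -> R -> R) :
  (forall i, cont_compact (f i)) -> cont_compact (fun y => \sum_(i <- r) f i y).
Proof.
move=> cf; elim: r => [|i r IH].
  by under eq_fun do rewrite big_nil; exact: cont_compact0.
by under eq_fun do rewrite big_cons; exact: cont_compactD.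
Qed.

Lemma dx_inv_sum (I : Type) (r : seq I) (f : I -> R -> R) x :
  (forall i, cont_compact (f i)) ->
  dx_inv (fun y => \sum_(i <- r) f i y) x = \sum_(i <- r) dx_inv (f i) x.
Proof.
move=> cf; elim: r => [|i r IH].
  rewrite big_nil; under [X in dx_inv X]eq_fun do rewrite big_nil -(mul0r 0).
  by rewrite dx_invZ ?mul0r//; exact: cont_compact0.
rewrite big_cons -IH -dx_invD//; last exact: cont_compact_sum.
by congr (dx_inv _ x); apply/funext => y; rewrite big_cons.
Qed.

Lemma dx_inv_ends f (M : R) : 0 <= M -> continuous f -> zero_beyond M f ->
  exists c, forall x, M <= x -> dx_inv f x = c /\ dx_inv f (- x) = - c.
Proof.
move=> M0 cf fM; have cc : cont_compact f by split => //; exists M.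
(* To the right of the support the primitive is the total integral, to the left it is 0; subtracting
   half of the total gives opposite values. *)
exists (2^-1 * \int[mu]_y f y) => x Mx; split; rewrite dx_invE//.
  rewrite -(@Rintegral_eq_support setT)//.
    rewrite -[X in X - _](mul1r (\int[mu]_y f y)) -mulrBl; congr (_ * _).
    by rewrite {1}[1]splitr mul1r addrK.
  move=> y _ /= ny; apply: fM; move/negP: ny; rewrite in_itv/= -ltNge => xy.
  by rewrite (le_trans Mx)// (le_trans (ltW xy))// ler_norm.
rewrite (@Rintegral_eq_support _ set0)//.
  by rewrite Rintegral_set0 sub0r.
move=> y /= + _; rewrite in_itv/= => yx; apply: fM.
by rewrite -normrN (le_trans _ (ler_norm _))// (le_trans Mx)// lerNr.
Qed.

Lemma derive_eq0_cst f x y : (forall z : R, is_derive z 1 f 0) -> f x = f y.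
Proof.
move=> df.
have [t _|t _ E] := @mvt_line R R f x 1 (y - x); first by have [] := df (x + t *: 1).
have [_ d0] := df (x + t *: 1); move: E.
have -> : x + (y - x)%:A = y by rewrite -[_%:A]/((y - x) * 1) mulr1 addrC subrK.
rewrite d0 mulr0.
by move/eqP; rewrite subr_eq0 => /eqP ->.
Qed.

(** [F] and [dx_inv f] have the same derivative, hence differ by a constant. Since [F] has equal
    values at the two ends, so does [dx_inv f]; but its end values are opposite, so both are 0, and
    they are plus and minus half of the integral. *)
Lemma Rintegral_derive_eq0 (F f : R -> R) (M : R) :
  (forall x : R, is_derive x 1 F (f x)) -> continuous f -> zero_beyond M f ->
  (exists c, forall x, M <= `|x| -> F x = c) -> \int[mu]_x f x = 0.
Proof.
move=> dF cf fM [c Fc].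
have cc : cont_compact f by split => //; exists M.
pose M' := Num.max M 0.
have M'0 : 0 <= M' by rewrite le_max lexx orbT.
have MM' : M <= M' by rewrite le_max lexx.
have [k kP] := dx_inv_ends M'0 cf (zero_beyondW MM' fM).
have [k1 k2] := kP M' (lexx _).
have dz (z : R) : is_derive z 1 (dx_inv f - F) 0.
  have d1 := is_derive_dx_inv z cc; have d2 := dF z.
  by apply: is_derive_eq; rewrite subrr.
have : (dx_inv f - F) M' = (dx_inv f - F) (- M') by exact: derive_eq0_cst.
rewrite /= -![(_ - _) _]/(_ - _) k1 k2 !Fc ?normrN ?ger0_norm//.
move/addIr => kk.
have k0 : k = 0 by lra.
have := dx_invE M' cc; rewrite k1 k0.
rewrite -(@Rintegral_eq_support setT)//.
  move/esym/eqP; rewrite -[X in X - _](mul1r (\int[mu]_y f y)) -mulrBl.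
  rewrite mulf_eq0 => /orP[|/eqP//].
  by rewrite {1}[1]splitr mul1r addrK invr_eq0 pnatr_eq0.
move=> y _ /= ny; apply: fM; move/negP: ny; rewrite in_itv/= -ltNge => xy.
by rewrite (le_trans MM')// (le_trans (ltW xy))// ler_norm.
Qed.

End LineIntegrals.


(** * Integrals over the line depending on parameters *)

Section ParametricIntegrals.
Context {R : realType} {k : nat}.
Notation mu := (@lebesgue_measure R).
Notation V := 'rV[R]_k.
Variables (O : set V) (oO : open O).
Implicit Types (f : V * R -> R) (s t e : V) (D : set R).

Lemma open_setXT : open (O `*` [set: R]).
Proof.
rewrite openE => -[t x] [Ot _]; exists (O, setT) => //=.
by split; [exact: open_nbhs_nbhs|exact: filterT].
Qed.
Hint Resolve open_setXT : core.

(** Boundedness of the support for each parameter separately would not do: mass could escape to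
    infinity as the parameter varies, and the integrals would be discontinuous. *)
Definition loc_zero_beyond (W : normedModType R) (f : V * R -> W) :=
  forall s, O s -> exists2 M : R, 0 <= M &
    \forall t \near s, forall x, M <= `|x| -> f (t, x) = 0.

Lemma derive_slice1 (W : normedModType R) (f : V * R -> W) (e t : V) x :
  'D_(e, 0) f (t, x) = 'D_e (fun t => f (t, x)) t.
Proof. by apply/esym/derive_line => h; rewrite -[RHS]/(f (_, h * 0 + x)) mulr0 add0r. Qed.

Lemma derive_slice2 (W : normedModType R) (f : V * R -> W) t (x : R) :
  'D_((0, 1) : V * R) f (t, x) = 'D_1 (fun y => f (t, y)) x.
Proof. by apply/esym/derive_line => h; rewrite -[RHS]/(f (h *: 0 + t, _)) scaler0 add0r. Qed.

Lemma derivable_slice1 (W : normedModType R) (f : V * R -> W) (e t : V) x :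
  derivable f (t, x) (e, 0) -> derivable (fun t => f (t, x)) t e.
Proof. by apply: derivable_line => h; rewrite -[RHS]/(f (_, h * 0 + x)) mulr0 add0r. Qed.

Lemma derivable_slice1K (W : normedModType R) (f : V * R -> W) (e t : V) x :
  derivable (fun t => f (t, x)) t e -> derivable f (t, x) (e, 0).
Proof. by apply: derivable_line => h; rewrite -[LHS]/(f (_, h * 0 + x)) mulr0 add0r. Qed.

Lemma derivable_slice2 (W : normedModType R) (f : V * R -> W) t (x : R) :
  derivable f (t, x) ((0, 1) : V * R) -> derivable (fun y => f (t, y)) x 1.
Proof. by apply: derivable_line => h; rewrite -[RHS]/(f (h *: 0 + t, _)) scaler0 add0r. Qed.

Lemma derivable_slice2K (W : normedModType R) (f : V * R -> W) t (x : R) :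
  derivable (fun y => f (t, y)) x 1 -> derivable f (t, x) ((0, 1) : V * R).
Proof. by apply: derivable_line => h; rewrite -[LHS]/(f (h *: 0 + t, _)) scaler0 add0r. Qed.

(** Enlarging the bound by 1 makes [f] vanish on a whole neighbourhood of the point in both
    variables, so that its derivatives in all directions vanish there too. *)
Lemma near_zero_beyond (W : normedModType R) (f : V * R -> W) s (M : R) :
  (\forall t \near s, forall x, M <= `|x| -> f (t, x) = 0) ->
  \forall t \near s, forall x, M + 1 <= `|x| -> \forall p \near (t, x), f p = 0.
Proof.
move=> /nbhs_interior; apply: filterS => t tM x Mx.
have xM : \forall y \near x, M <= `|y|.
  have cn : `|y| @[y --> x] --> `|x| by exact: norm_continuous.
  by apply: (cvgr_ge _ cn); rewrite (lt_le_trans _ Mx)// ltrDl.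
exists ([set t | forall x, M <= `|x| -> f (t, x) = 0], [set y | M <= `|y|]) => //=.
by move=> [t' y] /= [] /[apply].
Qed.

Lemma loc_zero_beyond_derive (W : normedModType R) (f : V * R -> W) v :
  loc_zero_beyond f -> loc_zero_beyond ('D_v f).
Proof.
move=> fM s Os; have [M M0 nM] := fM s Os; exists (M + 1); first exact: addr_ge0.
apply: filterS (near_zero_beyond nM) => t tM x Mx.
rewrite (@near_eq_derive _ _ _ f (cst 0)); first exact: derive_cst.
exact: tM.
Qed.

Lemma smooth_slice_continuous (W : normedModType R) (f : V * R -> W) s :
  smooth_on (O `*` setT) f -> O s -> continuous (fun x => f (s, x)).
Proof.
move=> fS Os x; have cf : {for (s, x), continuous f} by exact: smooth_continuous fS _.
apply: (@continuous_comp _ _ _ (fun y => (s, y)) f) => //.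
move=> B [[P Q] [/= nP nQ] PQ]; apply: filterS nQ => y Qy.
by apply: PQ; split => //=; exact: nbhs_singleton.
Qed.

(** Joint continuity at each point together with compactness of the segment. *)
Lemma near_uniform f s (M eps : R) : smooth_on (O `*` setT) f -> O s -> 0 < eps ->
  \forall t \near s, forall x, `|x| <= M -> `|f (t, x) - f (s, x)| <= eps.
Proof.
move=> fS Os eps0.
have := @segment_compact R (- M) M => /compact_near_coveringP.
move=> /(_ _ (nbhs s) (fun t x => `|f (t, x) - f (s, x)| <= eps) _).
move=> /(_ _)/filterS; apply => [t tM x|x _]; first by rewrite ler_norml => xM; exact: tM.
have e20 : 0 < eps / 2 by rewrite divr_gt0.
have cf : {for (s, x), continuous f} by exact: smooth_continuous fS _.
have /cvgrPdist_le/(_ _ e20) [[A B] /= [nA nB] AB] := cf.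
exists (B, A) => //= -[y t] /= [By At].
apply: (le_trans (ler_distD (f (s, x)) _ _)); rewrite [leRHS]splitr; apply: lerD.
  by rewrite distrC; apply: (AB (t, y)).
by apply: (AB (s, y)); split => //=; exact: nbhs_singleton.
Qed.

Lemma slice_cont_compact f s : smooth_on (O `*` setT) f -> loc_zero_beyond f ->
  O s -> cont_compact (fun x => f (s, x)).
Proof.
move=> fS fM Os; split; first exact: smooth_slice_continuous.
by have [M _ nM] := fM s Os; exists M; exact: nbhs_singleton nM.
Qed.

Definition pint D f s : R := \int[mu]_(x in D) f (s, x).

(** The neighbourhood of [s] is chosen before [D], since in [continuous_pdx_inv] the half-line moves
    together with the parameter. *)
Lemma near_pint f s (eps : R) : smooth_on (O `*` setT) f -> loc_zero_beyond f ->
  O s -> 0 < eps ->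
  \forall t \near s, forall D, measurable D -> `|pint D f t - pint D f s| <= eps.
Proof.
move=> fS fM Os eps0; have [M M0 nM] := fM s Os.
have M20 : 0 < 2 * M + 1 by rewrite ltr_wpDl// mulr_ge0.
have nu := near_uniform M fS Os (divr_gt0 eps0 M20).
have nO : \forall t \near s, O t by exact: open_nbhs_nbhs.
have sM := nbhs_singleton nM.
apply: filterS3 nO nM nu => t Ot tM tu D mD.
have ct := slice_cont_compact fS fM Ot; have cs := slice_cont_compact fS fM Os.
have -> : pint D f t - pint D f s = \int[mu]_(x in D) (f (t, x) - f (s, x)).
  by rewrite RintegralB//; exact: cont_compact_integrable.
apply: (@le_trans _ _ (eps / (2 * M + 1) * (2 * M))).
  apply: Rintegral_bound => //.
  - by move=> x; apply: cvgB; [exact: ct.1|exact: cs.1].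
  - by move=> x Mx; rewrite tM// sM// subrr.
  - move=> x; have [/tu//|/ltW Mx] := leP `|x| M.
    by rewrite tM// sM// subrr normr0 divr_ge0// ltW.
by rewrite mulrAC ler_pdivrMr// ler_wpM2l ?(ltW eps0)// lerDl.
Qed.

(** Differentiation under the integral. By the mean value theorem the difference quotient at each x
    is a value of the parameter derivative at a nearby parameter, and that derivative varies
    uniformly little on the common support. *)
Lemma is_derive_pint D f s e : measurable D -> smooth_on (O `*` setT) f ->
  loc_zero_beyond f -> O s -> is_derive s e (pint D f) (pint D ('D_(e, 0) f) s).
Proof.
move=> mD fS fM Os.
have DS : smooth_on (O `*` setT) ('D_(e, 0) f) by exact: smooth_derive.
have DM : loc_zero_beyond ('D_(e, 0) f) by exact: loc_zero_beyond_derive.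
suff G : (fun h : R => h^-1 *: ((pint D f \o shift s) (h *: e) - pint D f s)) @ 0^' -->
    pint D ('D_(e, 0) f) s.
  by apply: DeriveDef; [apply/cvg_ex; eexists; exact: G|exact: cvg_lim].
apply/cvgrPdist_le => eps eps0.
have [M0 M00 nM0] := fM s Os; have [M1 M10 nM1] := DM s Os.
pose M := Num.max M0 M1; have MM0 : M0 <= M by rewrite le_max lexx.
have MM1 : M1 <= M by rewrite le_max lexx orbT.
have Mge0 : 0 <= M by rewrite (le_trans M00).
have M20 : 0 < 2 * M + 1 by rewrite ltr_wpDl// mulr_ge0.
(* An error [eps'] over an interval of length [2 * M] integrates to at most [eps]; the summand 1
   covers [M = 0]. *)
pose eps' := eps / (2 * M + 1).
have eps'0 : 0 < eps' by rewrite divr_gt0.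
have nu := near_uniform M DS Os eps'0.
have nO : \forall t \near s, O t by exact: open_nbhs_nbhs.
have /nbhs_ballP[d /= d0 dP] : \forall t \near s, (O t /\
    forall x, M0 <= `|x| -> f (t, x) = 0) /\ forall x, `|x| <= M ->
    `|'D_(e, 0) f (t, x) - 'D_(e, 0) f (s, x)| <= eps'.
  exact: filterI (filterI nO nM0) nu.
have s0M0 := nbhs_singleton nM0; have s0M1 := nbhs_singleton nM1.
have hd : \forall h \near (0 : R)^', `|h| < d / (`|e| + 1).
  by apply: dnbhs0_lt; rewrite divr_gt0// ltr_wpDl.
near=> h.
have h0 : h != 0 by near: h; exact: nbhs_dnbhs_neq.
have hlt : `|h| < d / (`|e| + 1) by near: h.
have inb (t : R) : `|t| <= `|h| -> ball s d (s + t *: e).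
  move=> th; rewrite -ball_normE /= opprD addNKr normrN normrZ.
  rewrite (@le_lt_trans _ _ (`|h| * (`|e| + 1)))//; last by rewrite -ltr_pdivlMr// ltr_wpDl.
  by rewrite ler_pM// lerDl.
have [[Oh hM0] hu] := dP _ (inb h (lexx _)).
have ch := slice_cont_compact fS fM Oh; have cs := slice_cont_compact fS fM Os.
have cD := slice_cont_compact DS DM Os.
have -> : pint D ('D_(e, 0) f) s - h^-1 *: ((pint D f \o shift s) (h *: e) - pint D f s) =
    \int[mu]_(x in D) ('D_(e, 0) f (s, x) + - h^-1 * (f (s + h *: e, x) + -1 * f (s, x))).
  rewrite RintegralD_compact//; last first.
    by apply/cont_compactZ/cont_compactD => //; exact: cont_compactZ.
  rewrite RintegralZ_compact//; last by apply: cont_compactD => //; exact: cont_compactZ.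
  rewrite RintegralD_compact//; last exact: cont_compactZ.
  by rewrite RintegralZ_compact// mulN1r mulNr /= [h *: e + s]addrC.
(* The intermediate [t] depends on x without any regularity; all that is used of it is that
   [s + t *: e] stays in the ball. *)
have pw x : 'D_(e, 0) f (s, x) + - h^-1 * (f (s + h *: e, x) + -1 * f (s, x)) = 0 \/
    exists2 t : R, ball s d (s + t *: e) &
    'D_(e, 0) f (s, x) + - h^-1 * (f (s + h *: e, x) + -1 * f (s, x)) =
    'D_(e, 0) f (s, x) - 'D_(e, 0) f (s + t *: e, x).
  right; have pE (t : R) : (s, x) + t *: ((e, 0) : V * R) = (s + t *: e, x).
    by rewrite -[LHS]/(_, x + t * 0) mulr0 addr0.
  have dt (t : R) : `|t| <= `|h| -> derivable f ((s, x) + t *: ((e, 0) : V * R)) (e, 0).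
    move=> th; rewrite pE; apply: (smooth_derivable fS).
    by have [[Ot _] _] := dP _ (inb t th); exact: (conj Ot I).
  have [t th tE] := mvt_line dt.
  exists t; first exact: inb.
  by rewrite !pE in tE; rewrite mulN1r tE mulNr mulrA mulVf// mul1r.
apply: (@le_trans _ _ (eps' * (2 * M))).
  apply: Rintegral_bound => //.
  - have : cont_compact (fun x => 'D_(e, 0) f (s, x) + - h^-1 * (f (s + h *: e, x) + -1 * f (s, x))).
      by apply/cont_compactD/cont_compactZ/cont_compactD => //; exact: cont_compactZ.
    by case.
  - move=> x Mx; rewrite s0M1 ?(le_trans MM1)// hM0 ?(le_trans MM0)//.
    by rewrite s0M0 ?(le_trans MM0)// mulr0 addr0 mulr0 addr0.
  - move=> x; have [xM|/ltW Mx] := leP `|x| M.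
      have [->|[t tb ->]] := pw x; first by rewrite normr0 ltW.
      by rewrite distrC; have [_] := dP _ tb; exact.
    rewrite s0M1 ?(le_trans MM1)// hM0 ?(le_trans MM0)//.
    by rewrite s0M0 ?(le_trans MM0)// mulr0 addr0 mulr0 addr0 normr0 ltW.
by rewrite /eps' mulrAC ler_pdivrMr// ler_wpM2l ?(ltW eps0)// lerDl.
Unshelve. all: by end_near. Qed.

Lemma derive_pint D f s e : measurable D -> smooth_on (O `*` setT) f ->
  loc_zero_beyond f -> O s -> 'D_e (pint D f) s = pint D ('D_(e, 0) f) s.
Proof. by move=> mD fS fM Os; have [] := is_derive_pint e mD fS fM Os. Qed.

Lemma smooth_pint D f : measurable D -> smooth_on (O `*` setT) f ->
  loc_zero_beyond f -> smooth_on O (pint D f).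
Proof.
move=> mD fS fM n; elim: n f fS fM => [|n IH] f fS fM.
  move=> s Os; apply/(@cvgrPdist_le _ _ _ (nbhs s)) => eps eps0.
  apply: filterS (near_pint fS fM Os eps0) => t tP; rewrite distrC; exact: tP.
apply: (is_CkS_coordinates (coordinates_rV k) oO) => [i s Os|i].
  by have [] := is_derive_pint (delta_mx 0 i) mD fS fM Os.
apply: (is_Ck_eq oO _ (IH _ (smooth_derive (delta_mx 0 i, 0) fS)
  (loc_zero_beyond_derive (delta_mx 0 i, 0) fM))) => s Os.
by rewrite -derive_pint.
Qed.

Definition pdx_inv f (p : V * R) : R := dx_inv (fun y => f (p.1, y)) p.2.

Lemma is_derive_pdx_inv1 f s x e : smooth_on (O `*` setT) f ->
  loc_zero_beyond f -> O s ->
  is_derive ((s, x) : V * R) (e, 0) (pdx_inv f) (pdx_inv ('D_(e, 0) f) (s, x)).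
Proof.
move=> fS fM Os.
have d1 := @is_derive_pint `]-oo, x] f s e (measurable_itv _) fS fM Os.
have d2 := @is_derive_pint `[x, +oo[ f s e (measurable_itv _) fS fM Os.
have [d v] : is_derive s e (fun t => pdx_inv f (t, x)) (pdx_inv ('D_(e, 0) f) (s, x)).
  have -> : (fun t => pdx_inv f (t, x)) = 2^-1 *: (pint `]-oo, x] f - pint `[x, +oo[ f) by [].
  exact: is_derive_eq.
by apply: DeriveDef; [exact: derivable_slice1K|rewrite derive_slice1].
Qed.

Lemma is_derive_pdx_inv2 f s x : smooth_on (O `*` setT) f ->
  loc_zero_beyond f -> O s ->
  is_derive ((s, x) : V * R) (0, 1) (pdx_inv f) (f (s, x)).
Proof.
move=> fS fM Os; have [d v] := is_derive_dx_inv x (slice_cont_compact fS fM Os).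
by apply: DeriveDef; [exact: derivable_slice2K|rewrite derive_slice2].
Qed.

(** First the parameter is moved with the endpoint fixed, where [near_pint] is uniform in the
    endpoint; then the endpoint is moved at the fixed parameter [s]. *)
Lemma continuous_pdx_inv f p : smooth_on (O `*` setT) f ->
  loc_zero_beyond f -> O p.1 -> {for p, continuous (pdx_inv f)}.
Proof.
case: p => s x fS fM Os; apply/cvgrPdist_le => eps eps0.
have e20 : 0 < eps / 2 by rewrite divr_gt0.
have [d _] := is_derive_dx_inv x (slice_cont_compact fS fM Os).
have /cvgrPdist_le/(_ _ e20) nx := differentiable_continuous (iffLR (derivable1_diffP _ _) d).
have ns := near_pint fS fM Os e20.
exists ([set t | forall D, measurable D -> `|pint D f t - pint D f s| <= eps / 2],
  [set y | `|dx_inv (fun z => f (s, z)) x - dx_inv (fun z => f (s, z)) y| <= eps / 2]) => //.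
move=> [t y] /= [tP yP].
apply: (le_trans (ler_distD (pdx_inv f (s, y)) _ _)); rewrite [leRHS]splitr; apply: lerD => //.
rewrite distrC.
have -> : pdx_inv f (t, y) - pdx_inv f (s, y) =
    2^-1 * ((pint `]-oo, y] f t - pint `]-oo, y] f s) -
            (pint `[y, +oo[ f t - pint `[y, +oo[ f s)).
  have E (r a b c d' : R) : r * (a - b) - r * (c - d') = r * ((a - c) - (b - d')) by ring.
  exact: E.
rewrite normrM ger0_norm ?invr_ge0// mulrC ler_pdivrMr//.
rewrite (le_trans (ler_normB _ _))// mulr2n mulrDr mulr1 lerD//; exact: tP.
Qed.

(** Induction on the order with [f] generalised: a parameter derivative passes inside [pdx_inv], and
    the x-derivative gives back [f], which is already smooth. *)
Lemma smooth_pdx_inv f : smooth_on (O `*` setT) f ->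
  loc_zero_beyond f -> smooth_on (O `*` setT) (pdx_inv f).
Proof.
move=> fS fM n; elim: n f fS fM => [|n IH] f fS fM.
  by move=> p [Op _]; exact: continuous_pdx_inv.
apply: (is_CkS_coordinates (coordinates_rVR k)) => // [i [s x] [Os _]|i].
  case: unliftP => [j|] _.
    by have [] := is_derive_pdx_inv1 x (delta_mx 0 j) fS fM Os.
  by have [] := is_derive_pdx_inv2 x fS fM Os.
case: unliftP => [j|] _.
  apply: (is_Ck_eq open_setXT _ (IH _ (smooth_derive (delta_mx 0 j, 0) fS)
    (loc_zero_beyond_derive (delta_mx 0 j, 0) fM))) => -[s x] [Os _].
  by have [_ ->] := is_derive_pdx_inv1 x (delta_mx 0 j) fS fM Os.
apply: (is_Ck_eq open_setXT _ (fS n)) => -[s x] [Os _].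
by have [_ ->] := is_derive_pdx_inv2 x fS fM Os.
Qed.

End ParametricIntegrals.


(** * The dot product of rows *)

Section DotProduct.
Context {R : realType}.

Definition dotp {N} (x y : 'rV[R]_N) : R := \sum_i x 0 i * y 0 i.

Context {N : nat}.
Implicit Types x y z : 'rV[R]_N.

Lemma dotpC x y : dotp x y = dotp y x.
Proof. by apply: eq_bigr => i _; rewrite mulrC. Qed.

Lemma dotpDl x y z : dotp (x + y) z = dotp x z + dotp y z.
Proof. by rewrite -big_split; apply: eq_bigr => i _; rewrite mxE mulrDl. Qed.

Lemma dotpDr x y z : dotp x (y + z) = dotp x y + dotp x z.
Proof. by rewrite dotpC dotpDl !(dotpC x). Qed.

Lemma dotpZl (r : R) x y : dotp (r *: x) y = r * dotp x y.
Proof. by rewrite mulr_sumr; apply: eq_bigr => i _; rewrite mxE mulrA. Qed.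

Lemma dotpZr (r : R) x y : dotp x (r *: y) = r * dotp x y.
Proof. by rewrite dotpC dotpZl dotpC. Qed.

Lemma dotpBl x y z : dotp (x - y) z = dotp x z - dotp y z.
Proof. by rewrite dotpDl -scaleN1r dotpZl mulN1r. Qed.

Lemma dotpE x y : dotp x y = (x *m y^T) 0 0.
Proof. by rewrite mxE; apply: eq_bigr => i _; rewrite mxE. Qed.

Lemma dotp_mulmx x y (M : 'M[R]_N) : dotp (x *m M) y = dotp x (y *m M^T).
Proof. by rewrite !dotpE trmx_mul trmxK mulmxA. Qed.

Lemma dotp0l x : dotp 0 x = 0.
Proof. by rewrite -(scale0r 0) dotpZl mul0r. Qed.

Lemma dotp0r x : dotp x 0 = 0.
Proof. by rewrite dotpC dotp0l. Qed.

Lemma smooth_dotp (V : normedModType R) (A : set V) (f g : V -> 'rV[R]_N) : open A ->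
  smooth_on A f -> smooth_on A g -> smooth_on A (fun q => dotp (f q) (g q)).
Proof.
move=> oA fS gS; apply: smooth_sum => // i.
by apply: smoothM => //; exact: smooth_coord.
Qed.

Lemma derive_dotp (V : normedModType R) (f g : V -> 'rV[R]_N) p v :
  derivable f p v -> derivable g p v ->
  'D_v (fun q => dotp (f q) (g q)) p = dotp ('D_v f p) (g p) + dotp (f p) ('D_v g p).
Proof.
move=> df dg.
have -> : (fun q => dotp (f q) (g q)) = \sum_i (fun q => f q 0 i * g q 0 i).
  by apply/funext => q; rewrite fct_sumE.
have dfi i := (derivable_mxP f p v).1 df 0 i.
have dgi i := (derivable_mxP g p v).1 dg 0 i.
rewrite derive_sum; last first.
  by move=> i; apply: derivableM; [exact: dfi|exact: dgi].
rewrite -big_split/=; apply: eq_bigr => i _.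
rewrite -[fun q => _]/((fun q => f q 0 i) * (fun q => g q 0 i)) deriveM//.
rewrite (derive_coord 0 i dg) (derive_coord 0 i df) addrC; congr (_ + _).
exact: mulrC.
Qed.

Lemma derive_mulmxr (V : normedModType R) m q r (f : V -> 'M[R]_(m, q)) (C : 'M[R]_(q, r)) p v :
  derivable f p v -> 'D_v (fun q => f q *m C) p = 'D_v f p *m C.
Proof.
move=> df; rewrite derive_mulmx//.
by rewrite (derive_cst C) mulmx0 addr0.
Qed.

End DotProduct.

(** * Behaviour at the two ends of the line *)

Section Ends.
Context {R : realType} {k : nat}.
Notation V := 'rV[R]_k.
Variables (O : set V) (oO : open O).
Let oP := open_setXT oO.
Implicit Types (W : normedModType R) (s t e : V).
Notation P := (O `*` [set: R]).
Notation zb := (@loc_zero_beyond _ _ O _).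

Lemma near_open s : O s -> \forall t \near s, O t.
Proof. by move=> Os; exact: open_nbhs_nbhs. Qed.

Lemma loc_zero_beyond_eq W (f g : V * R -> W) :
  (forall p, P p -> f p = g p) -> zb f -> zb g.
Proof.
move=> fg fM s Os; have [M M0 nM] := fM s Os; exists M => //.
apply: filterS2 (near_open Os) nM => t Ot tM x Mx; rewrite -fg ?tM//.
Qed.

Lemma loc_zero_beyond_comp2 W1 W2 W (op : W1 -> W2 -> W) (f : V * R -> W1) (g : V * R -> W2) :
  op 0 0 = 0 -> zb f -> zb g -> zb (fun p => op (f p) (g p)).
Proof.
move=> op0 fM gM s Os; have [M M0 nM] := fM s Os; have [M' M'0 nM'] := gM s Os.
exists (Num.max M M'); first by rewrite le_max M0.
apply: filterS2 nM nM' => t tM tM' x; rewrite ge_max => /andP[/tM -> /tM' ->].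
exact: op0.
Qed.

Lemma loc_zero_beyondD W (f g : V * R -> W) : zb f -> zb g -> zb (fun p => f p + g p).
Proof. by apply: loc_zero_beyond_comp2; rewrite addr0. Qed.

Lemma loc_zero_beyondB W (f g : V * R -> W) : zb f -> zb g -> zb (fun p => f p - g p).
Proof. by apply: (loc_zero_beyond_comp2 (op := fun x y => x - y)); rewrite subr0. Qed.

(** For products in which one factor of bounded support suffices, such as a derivative of the field
    times a covector. *)
Lemma loc_zero_beyond_comp1 W1 W2 W (op : W1 -> W2 -> W) (f : V * R -> W1) (g : V * R -> W2) :
  (forall y, op 0 y = 0) -> zb f -> zb (fun p => op (f p) (g p)).
Proof.
move=> op0 fM s Os; have [M M0 nM] := fM s Os; exists M => //.
by apply: filterS nM => t tM x /tM ->.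
Qed.

Lemma loc_zero_beyondZ W (r : R) (f : V * R -> W) : zb f -> zb (fun p => r *: f p).
Proof.
apply: (loc_zero_beyond_comp1 (op := fun x (y : R) => r *: x) (fun=> 0 : R)).
by move=> _; rewrite scaler0.
Qed.

Lemma loc_zero_beyond_mulmx m n q (f : V * R -> 'M[R]_(m, n)) (g : V * R -> 'M[R]_(n, q)) :
  zb f \/ zb g -> zb (fun p => f p *m g p).
Proof.
move=> [] z; first by apply: loc_zero_beyond_comp1 z => y; rewrite mul0mx.
by apply: (loc_zero_beyond_comp1 (op := fun x y => y *m x)) z => y; rewrite mulmx0.
Qed.

Lemma loc_zero_beyond_dotp N (f g : V * R -> 'rV[R]_N) :
  zb f \/ zb g -> zb (fun p => dotp (f p) (g p)).
Proof.
move=> [] z; first by apply: loc_zero_beyond_comp1 z => y; rewrite dotp0l.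
by apply: (loc_zero_beyond_comp1 (op := fun x y => dotp y x)) z => y; rewrite dotp0r.
Qed.

Lemma loc_zero_beyond_coord m n (f : V * R -> 'M[R]_(m, n)) i j :
  zb f -> zb (fun p => f p i j).
Proof.
apply: (loc_zero_beyond_comp1 (op := fun (x : 'M[R]_(m, n)) (y : R) => x i j) (fun=> 0 : R)).
by move=> _; rewrite mxE.
Qed.

Lemma loc_zero_beyond_mx m n (f : V * R -> 'M[R]_(m, n)) :
  (forall i j, zb (fun p => f p i j)) -> zb f.
Proof.
move=> fM; have S : zb (fun p => \sum_i \sum_j f p i j *: delta_mx i j : 'M[R]_(m, n)).
  have sumz W (I : Type) (r : seq I) (h : I -> V * R -> W) : (forall i, zb (h i)) ->
      zb (fun p => \sum_(i <- r) h i p).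
    move=> hM; elim: r => [|i r IH].
      by move=> s Os; exists 0 => //; apply: filterE => t x _; rewrite big_nil.
    by under eq_fun do rewrite big_cons; apply: (loc_zero_beyondD (hM i) IH).
  apply: (sumz 'M[R]_(m, n)) => i; apply: (sumz 'M[R]_(m, n)) => j.
  apply: (loc_zero_beyond_comp1 (op := fun (x y : R) => x *: delta_mx i j) (fun=> 0 : R)) => //.
  by move=> _; rewrite scale0r.
by apply: loc_zero_beyond_eq S => p _; rewrite -matrix_sum_delta.
Qed.

(* sigma is 1 for covectors and -1 for values of dx_inv; a product of two of the
   latter again has equal limits at both ends. *)
Definition ends (sigma : R) W (f : V * R -> W) :=
  forall s, O s -> exists2 M : R, 0 <= M &
    \forall t \near s, exists c, forall x, M <= x ->
      f (t, x) = c /\ f (t, - x) = sigma *: c.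

Lemma ends_zero (sigma : R) W (f : V * R -> W) : zb f -> ends sigma f.
Proof.
move=> fM s Os; have [M M0 nM] := fM s Os; exists M => //.
apply: filterS nM => t tM; exists 0 => x Mx; rewrite scaler0.
have xM : M <= `|x| by rewrite (le_trans Mx)// ler_norm.
by split; apply: tM => //; rewrite normrN.
Qed.

Lemma ends_cst W (w : W) : ends 1 (fun=> w).
Proof.
by move=> s Os; exists 0 => //; apply: filterE => t; exists w => x _; rewrite scale1r.
Qed.

Lemma ends_comp2 (sigma tau rho : R) W1 W2 W (op : W1 -> W2 -> W)
    (f : V * R -> W1) (g : V * R -> W2) :
  (forall c d, op (sigma *: c) (tau *: d) = rho *: op c d) ->
  ends sigma f -> ends tau g -> ends rho (fun p => op (f p) (g p)).
Proof.
move=> opE fM gM s Os; have [M M0 nM] := fM s Os; have [M' M'0 nM'] := gM s Os.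
exists (Num.max M M'); first by rewrite le_max M0.
apply: filterS2 nM nM' => t [c cP] [d dP]; exists (op c d) => x.
by rewrite ge_max => /andP[/cP[-> ->] /dP[-> ->]].
Qed.

Lemma endsD (sigma : R) W (f g : V * R -> W) :
  ends sigma f -> ends sigma g -> ends sigma (fun p => f p + g p).
Proof. by apply: ends_comp2 => c d; rewrite scalerDr. Qed.

Lemma endsB (sigma : R) W (f g : V * R -> W) :
  ends sigma f -> ends sigma g -> ends sigma (fun p => f p - g p).
Proof. by apply: (ends_comp2 (op := fun x y => x - y)) => c d; rewrite scalerBr. Qed.

Lemma endsZ (sigma r : R) W (f : V * R -> W) :
  ends sigma f -> ends sigma (fun p => r *: f p).
Proof.
move=> fM; apply: (ends_comp2 (op := fun (x : W) (y : R) => r *: x) _ fM (ends_cst 0)).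
by move=> c d; rewrite !scalerA mulrC.
Qed.

Lemma ends_mulmxr (sigma : R) m n q (f : V * R -> 'M[R]_(m, n)) (C : 'M[R]_(n, q)) :
  ends sigma f -> ends sigma (fun p => f p *m C).
Proof.
move=> fM; apply: (ends_comp2 (op := fun (x : 'M[R]_(m, n)) (y : R) => x *m C) _ fM (ends_cst 0)).
by move=> c d; rewrite scalemxAl.
Qed.

Lemma ends_dotp (sigma tau : R) N (f g : V * R -> 'rV[R]_N) :
  ends sigma f -> ends tau g -> ends (sigma * tau) (fun p => dotp (f p) (g p)).
Proof. by apply: ends_comp2 => c d; rewrite dotpZl dotpZr mulrA. Qed.

Lemma ends_eq (sigma : R) W (f g : V * R -> W) :
  (forall p, P p -> f p = g p) -> ends sigma f -> ends sigma g.
Proof.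
move=> fg fM s Os; have [M M0 nM] := fM s Os; exists M => //.
apply: filterS2 (near_open Os) nM => t Ot [c cP]; exists c => x Mx.
by rewrite -!fg//; exact: cP.
Qed.

Lemma ends_derive1 (sigma : R) W (f : V * R -> W) e :
  smooth_on P f -> ends sigma f -> ends sigma ('D_(e, 0) f).
Proof.
move=> fS fM s Os; have [M M0 nM] := fM s Os; exists M => //.
apply: filterS2 (near_open Os) (nbhs_interior nM) => t Ot tM.
(* [ends] says nothing on how the end value depends on the parameter; it is recovered as the value
   of [f] at x = [M], which can be differentiated. *)
exists ('D_(e, 0) f (t, M)) => x Mx; split.
  rewrite !derive_slice1; apply: near_eq_derive.
  by apply: filterS tM => t' [c cP]; rewrite (cP x Mx).1 (cP M (lexx _)).1.
rewrite !derive_slice1 -deriveZ; last first.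
  by apply/derivable_slice1/smooth_derivable; [exact: fS|].
apply: near_eq_derive.
by apply: filterS tM => t' [c cP]; rewrite (cP x Mx).2 -(cP M (lexx _)).1.
Qed.

Lemma loc_zero_beyond_dX (sigma : R) W (f : V * R -> W) :
  ends sigma f -> zb (fun p => 'D_((0, 1) : V * R) f p).
Proof.
(* The margin 1 makes [f] constant in a neighbourhood of each x concerned. *)
move=> fM s Os; have [M M0 nM] := fM s Os; exists (M + 1); first exact: addr_ge0.
apply: filterS nM => t [c cP] x Mx; rewrite derive_slice2.
have [x0|x0] := leP 0 x.
  rewrite (@near_eq_derive _ _ _ _ (cst c)); first exact: derive_cst.
  have : \forall y \near x, M < y.
    apply: lt_nbhsr; rewrite ger0_norm// in Mx; rewrite (lt_le_trans _ Mx)//.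
    by rewrite ltrDl.
  by apply: filterS => y /ltW/cP[].
rewrite (@near_eq_derive _ _ _ _ (cst (sigma *: c))); first exact: derive_cst.
have : \forall y \near x, y < - M.
  apply: lt_nbhsl; rewrite ltr0_norm// in Mx; rewrite ltrNr (lt_le_trans _ Mx)//.
  by rewrite ltrDl.
by apply: filterS => y yM; have [|_] := cP (- y); rewrite ?opprK// lerNr ltW.
Qed.

(** The form in which all integrations by parts are carried out: two integrands that differ by such
    a total derivative have the same integral. *)
Lemma pint_dX_eq0 (f : V * R -> R) s : smooth_on P f -> ends 1 f -> O s ->
  pint setT ('D_((0, 1) : V * R) f) s = 0.
Proof.
move=> fS fM Os.
have [M _ /nbhs_singleton[c cP]] := fM s Os.
have DS := smooth_derive ((0, 1) : V * R) fS.
have Dz := loc_zero_beyond_dX fM.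
have [cD [M' zM']] := slice_cont_compact DS Dz Os.
apply: (@Rintegral_derive_eq0 R (fun x => f (s, x)) _ (Num.max M M')).
- move=> x; apply: DeriveDef; last by rewrite derive_slice2.
  by apply/derivable_slice2/smooth_derivable; [exact: fS|].
- exact: cD.
- by move=> x; rewrite ge_max => /andP[_ /zM'].
- exists c => x; rewrite ge_max => /andP[xM _].
  have [x0|x0] := leP 0 x; first by rewrite (cP x _).1// -[x in _ <= x]ger0_norm.
  rewrite -[x]opprK (cP (- x) _).2 ?scale1r//.
  by rewrite -ltr0_norm.
Qed.

Definition mdx N (b : V * R -> 'rV[R]_N) (p : V * R) : 'rV[R]_N :=
  \row_i pdx_inv (fun q => b q 0 i) p.

Variable N : nat.
Implicit Types b : V * R -> 'rV[R]_N.

Lemma smooth_mdx b : smooth_on P b -> zb b -> smooth_on P (mdx b).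
Proof.
move=> bS bz; apply: smooth_mx => // i j.
have S : smooth_on P (pdx_inv (fun q => b q 0 j)).
  by apply: smooth_pdx_inv => //; [exact: smooth_coord|exact: loc_zero_beyond_coord].
by apply: smooth_eq S => // p _; rewrite mxE.
Qed.

Lemma derive_mdx1 b p e : smooth_on P b -> zb b -> P p ->
  'D_(e, 0) (mdx b) p = mdx ('D_(e, 0) b) p.
Proof.
move=> bS bz Pp; have mS := smooth_mdx bS bz.
apply/rowP => i; rewrite -derive_coord; last exact: smooth_derivable mS Pp.
rewrite mxE; have -> : (fun y => mdx b y 0 i) = pdx_inv (fun q => b q 0 i).
  by apply/funext => y; rewrite mxE.
case: p Pp => s x [/= Os _].
have [_ ->] := is_derive_pdx_inv1 oO x e (smooth_coord oP 0 i bS)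
  (loc_zero_beyond_coord 0 i bz) Os.
congr (dx_inv _ _); apply/funext => y; rewrite derive_coord//.
by apply: smooth_derivable bS _.
Qed.

Lemma derive_mdx2 b p : smooth_on P b -> zb b -> P p ->
  'D_((0, 1) : V * R) (mdx b) p = b p.
Proof.
move=> bS bz Pp; have mS := smooth_mdx bS bz.
apply/rowP => i; rewrite -derive_coord; last exact: smooth_derivable mS Pp.
have -> : (fun y => mdx b y 0 i) = pdx_inv (fun q => b q 0 i).
  by apply/funext => y; rewrite mxE.
case: p Pp => s x [/= Os _].
by have [_ ->] := is_derive_pdx_inv2 x (smooth_coord oP 0 i bS)
  (loc_zero_beyond_coord 0 i bz) Os.
Qed.

Lemma ends_mdx b : smooth_on P b -> zb b -> ends (-1) (mdx b).
Proof.
move=> bS bz s Os; have [M M0 nM] := bz s Os; exists M => //.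
apply: filterS2 (near_open Os) nM => t Ot tM.
have ci i : continuous (fun y => b (t, y) 0 i).
  exact: smooth_slice_continuous (smooth_coord oP 0 i bS) Ot.
have zi i : zero_beyond M (fun y => b (t, y) 0 i).
  by move=> x /tM ->; rewrite mxE.
exists (\row_i sval (cid (dx_inv_ends M0 (ci i) (zi i)))) => x Mx.
split; apply/rowP => i; rewrite !mxE; case: cid => c /= /(_ x Mx) [e1 e2].
  exact: e1.
by rewrite mulN1r; exact: e2.
Qed.

End Ends.


(** * The pencil along a family of fields *)

Section ThirdDerivatives.
Context {R : realType} {N : nat}.
Variables (eta : 'M[R]_N) (U : set 'rV[R]_N) (Phi : 'rV[R]_N -> R).
Hypotheses (etaT : eta^T = eta) (oU : open U) (PhiS : smooth_on U Phi).
Hypothesis assoc : associativity U eta Phi.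
Implicit Types (u v x y z : 'rV[R]_N).

Lemma smooth_partial (f : 'rV[R]_N -> R) i : smooth_on U f -> smooth_on U (partial i f).
Proof. by move=> fS; exact: smooth_derive. Qed.

Lemma partialC (f : 'rV[R]_N -> R) i j u : smooth_on U f -> U u ->
  partial i (partial j f) u = partial j (partial i f) u.
Proof. by move=> fS Uu; exact: smooth_derive_commute fS Uu. Qed.

Lemma partial3C12 i j k u : U u -> partial3 Phi i j k u = partial3 Phi j i k u.
Proof. by move=> Uu; apply: partialC => //; exact: smooth_partial. Qed.

Lemma partial3C23 i j k u : U u -> partial3 Phi i j k u = partial3 Phi i k j u.
Proof.
move=> Uu; apply: near_eq_derive.
by apply: filterS (open_nbhs_nbhs (conj oU Uu)) => v Uv; exact: partialC.
Qed.

Lemma dotp_eta x y : dotp (x *m eta) y = dotp (y *m eta) x.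
Proof. by rewrite dotp_mulmx etaT dotpC. Qed.

Lemma dotp_etar x y : dotp x (y *m eta) = dotp (x *m eta) y.
Proof. by rewrite [RHS]dotp_mulmx etaT. Qed.

(* A is the x-derivative of the Hessian of Phi along the field, G its derivative
   in the parameter and G' the mixed one; ma, mb and md are values of dx_inv.
   The left-hand side is the integrand of the derivative of {I,J}; the last
   summand on the right is the x-derivative of
   l1 (x eta, zd) + l2 ((ma eta, md) + (x eta G, mb eta) - (z eta G, ma eta)). *)
Lemma variation_identity (l1 l2 : R) (x z xd zd xp zp zdp ma mb md : 'rV[R]_N)
    (A G G' : 'M[R]_N) :
  A^T = A -> G^T = G -> G *m eta *m A = A *m eta *m G ->
  l1 * (dotp (xd *m eta) zp + dotp (x *m eta) zdp) +
  l2 * (dotp ((xd *m eta *m A + x *m eta *m G') *m eta) mb +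
        dotp (x *m eta *m A *m eta) md) =
  l1 * dotp (xd *m eta) zp + l2 * dotp (xd *m eta *m A *m eta) mb -
  (l1 * dotp (zd *m eta) xp + l2 * dotp (zd *m eta *m A *m eta) ma) +
  l2 * (dotp (zp *m eta *m G) (ma *m eta) - dotp (xp *m eta *m G) (mb *m eta)) +
  (l1 * (dotp (xp *m eta) zd + dotp (x *m eta) zdp) +
   l2 * (dotp (x *m eta *m A *m eta) md +
         dotp (ma *m eta) (zd *m eta *m A + z *m eta *m G') +
         (dotp (xp *m eta *m G + x *m eta *m G') (mb *m eta) +
            dotp (x *m eta *m G) (z *m eta *m A *m eta) -
          (dotp (zp *m eta *m G + z *m eta *m G') (ma *m eta) +
            dotp (z *m eta *m G) (x *m eta *m A *m eta))))).
Proof.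
move=> AT GT GA.
(* These two terms come from differentiating the potentials in x; they agree because [A] and [G]
   commute through [eta], that is, by associativity. *)
have E : dotp (x *m eta *m G) (z *m eta *m A *m eta) =
    dotp (z *m eta *m G) (x *m eta *m A *m eta).
  rewrite dotp_etar dotpC dotp_mulmx AT [RHS]dotp_mulmx GT; congr (dotp _ _).
  by rewrite -!mulmxA [G *m (_ *m _)]mulmxA GA -!mulmxA.
rewrite E [dotp (ma *m eta) _]dotp_eta [dotp (zd *m eta) xp]dotp_eta !dotp_etar.
rewrite !mulmxDl !dotpDl.
by ring.
Qed.

Definition hess u : 'M[R]_N := \matrix_(i, j) partial i (partial j Phi) u.

(** The matrix M(y) of the overview, at the point [u]. *)
Definition third u y : 'M[R]_N := \matrix_(i, j) \sum_k partial3 Phi i j k u * y 0 k.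

Lemma third_sym u y : U u -> (third u y)^T = third u y.
Proof.
move=> Uu; apply/matrixP => i j; rewrite !mxE.
by apply: eq_bigr => k _; rewrite partial3C12.
Qed.

Lemma third_swap u x y : U u -> x *m third u y = y *m third u x.
Proof.
move=> Uu; apply/rowP => j; rewrite !mxE.
under eq_bigr do rewrite mxE mulr_sumr.
under [RHS]eq_bigr do rewrite mxE mulr_sumr.
rewrite exchange_big; apply: eq_bigr => i _; apply: eq_bigr => k _.
by rewrite partial3C12// partial3C23// partial3C12//; ring.
Qed.

Lemma third_assoc u x y : U u ->
  third u x *m eta *m third u y = third u y *m eta *m third u x.
Proof.
move=> Uu; apply/matrixP => i l.
(* Each entry is bilinear in the two vectors, with one side of the associativity equations as
   coefficients. Those equations exchange j and k, which exchanges the two vectors. *)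
have E (x' y' : 'rV[R]_N) : (third u x' *m eta *m third u y') i l =
    \sum_j \sum_k x' 0 j * y' 0 k *
      (\sum_m \sum_n eta m n * partial3 Phi i j m u * partial3 Phi n k l u).
  rewrite mxE; under eq_bigr => n _.
    rewrite mxE mxE big_distrl/=.
    under eq_bigr => m _.
      rewrite mxE 2!big_distrl/=.
      under eq_bigr => j _ do rewrite mulr_sumr.
      over.
    over.
  rewrite /=.
  under eq_bigr do rewrite exchange_big/=.
  rewrite exchange_big/=; apply: eq_bigr => j _.
  under eq_bigr do rewrite exchange_big/=.
  rewrite exchange_big/=; apply: eq_bigr => k _.
  rewrite exchange_big/= mulr_sumr; apply: eq_bigr => m _.
  rewrite mulr_sumr; apply: eq_bigr => n _.
  have -> : partial3 Phi i m j u = partial3 Phi i j m u by exact: partial3C23.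
  have -> : partial3 Phi n l k u = partial3 Phi n k l u by exact: partial3C23.
  by move: (partial3 Phi i j m u) (partial3 Phi n k l u) => p q; ring.
rewrite !E exchange_big/=; apply: eq_bigr => k _; apply: eq_bigr => j _.
apply: (etrans (congr1 (fun r => x 0 j * y 0 k * r) (assoc Uu i j k l))).
by rewrite (mulrC (x 0 j)).
Qed.

Lemma dotp_third u x y z : U u -> dotp (x *m third u y) z = dotp (x *m third u z) y.
Proof.
move=> Uu; rewrite third_swap// dotp_mulmx third_sym// dotpC; congr (dotp _ _).
by rewrite third_swap.
Qed.

(** By the symmetries of [third], the left-hand side is x M(q) eta M(r) paired with w, and M(q) and
    M(r) commute through [eta]. *)
Lemma dotp_third_swap u x q w r : U u ->
  dotp (x *m third u q) (r *m third u w *m eta) =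
  dotp (x *m third u r) (q *m third u w *m eta).
Proof.
move=> Uu.
have E q' r' : dotp (x *m third u q') (r' *m third u w *m eta) =
    dotp (x *m third u q' *m eta *m third u r') w.
  by rewrite dotp_etar [r' *m _]third_swap// dotpC dotp_mulmx third_sym// dotpC.
by rewrite !E -!(mulmxA x) third_assoc.
Qed.

Lemma third_cyclic (l1 l2 : R) u w (a b c qa qb qc : 'rV[R]_N) : U u ->
  dotp (b *m third u qa - a *m third u qb) (l1 *: c + l2 *: (qc *m third u w *m eta)) +
  dotp (c *m third u qb - b *m third u qc) (l1 *: a + l2 *: (qa *m third u w *m eta)) +
  dotp (a *m third u qc - c *m third u qa) (l1 *: b + l2 *: (qb *m third u w *m eta)) = 0.
Proof.
move=> Uu; rewrite !dotpDr !dotpZr !dotpBl.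
have sym x q y : dotp (x *m third u q) y = dotp (y *m third u q) x.
  by rewrite dotp_mulmx third_sym// dotpC.
(* After these swaps each of the six [l2] terms meets its opposite in another summand; the rewrites
   with [sym] do the same for the [l1] terms. *)
rewrite (dotp_third_swap b qa w qc Uu) (dotp_third_swap a qb w qc Uu).
rewrite (dotp_third_swap c qb w qa Uu).
rewrite (sym b qa c) (sym a qb c) (sym b qc a).
by ring.
Qed.

Section Composition.
Context {V : normedModType R}.
Variables (A : set V) (g : V -> 'rV[R]_N).
Hypotheses (oA : open A) (AU : forall p, A p -> U (g p)) (gS : smooth_on A g).

Lemma smooth_hess : smooth_on A (fun p => hess (g p)).
Proof.
apply: smooth_mx => // i j.
have S : smooth_on A (fun p => partial i (partial j Phi) (g p)).
  by apply: (smooth_comp_rV oA AU gS); do 2 apply: smooth_partial.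
by apply: smooth_eq S => // p _; rewrite mxE.
Qed.

Lemma derive_hess p (v : V) : A p -> 'D_v (fun p => hess (g p)) p = third (g p) ('D_v g p).
Proof.
move=> Ap; apply/matrixP => i j.
rewrite -derive_coord; last exact: smooth_derivable smooth_hess Ap.
have -> : (fun q => hess (g q) i j) = (fun q => partial i (partial j Phi) (g q)).
  by apply/funext => q; rewrite mxE.
rewrite derive_comp_rV; last 2 first.
- exact: smooth_differentiable gS Ap.
- by apply: (@smooth_differentiable _ _ U); [do 2 apply: smooth_partial|exact: AU].
rewrite mxE; apply: eq_bigr => k _.
(* The chain rule differentiates by the k-th variable last, whereas [partial3] takes the derivative
   of its last index first. *)
have -> : partial3 Phi i j k (g p) = 'D_(delta_mx 0 k) (partial i (partial j Phi)) (g p).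
  by apply: (etrans (partial3C23 _ _ _ (AU Ap))); exact: partial3C12 (AU Ap).
exact: mulrC.
Qed.

Lemma smooth_third (h : V -> 'rV[R]_N) : smooth_on A h ->
  smooth_on A (fun p => third (g p) (h p)).
Proof.
move=> hS; apply: smooth_mx => // i j.
have S : smooth_on A (fun p => \sum_k partial3 Phi i j k (g p) * h p 0 k).
  apply: smooth_sum => // k; apply: smoothM => //; last exact: smooth_coord.
  by apply: (smooth_comp_rV oA AU gS); do 3 apply: smooth_partial.
by apply: smooth_eq S => // p _; rewrite mxE.
Qed.

End Composition.

Section Family.
Context {k : nat}.
Notation V := 'rV[R]_k.
Variables (l1 l2 : R) (O : set V) (oO : open O) (g : V * R -> 'rV[R]_N)
  (a : 'rV[R]_N).
Notation P := (O `*` [set: R]).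
Hypotheses (PU : forall p, P p -> U (g p)) (gS : smooth_on P g).
Hypothesis ga : loc_zero_beyond O (fun p => g p - a).
Implicit Types xi zeta chi : V * R -> 'rV[R]_N.
Let oP := open_setXT oO.
Let X : V * R := (0, 1).

(** In the notation of the overview, along the family [g]: [third_x] is A, [cov_flux xi] the
    integrand of the nonlocal term, [potential xi] is q(xi) and [pencil_vec xi] the value of the
    pencil. *)
Definition third_x p := third (g p) ('D_X g p).
Definition cov_flux xi p := xi p *m eta *m third_x p.
Definition potential xi p := mdx (cov_flux xi) p *m eta.
Definition pencil_vec xi p :=
  l1 *: ('D_X xi p *m eta) + l2 *: (potential xi p *m third_x p *m eta).
(* The terms in which the potentials are differentiated instead of the covectors
   cancel by associativity. *)
Definition var_term xi zeta p :=
  'D_X zeta p *m eta *m third (g p) (potential xi p) -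
  'D_X xi p *m eta *m third (g p) (potential zeta p).

Definition covector_family xi := smooth_on P xi /\ ends O 1 xi.

Lemma zero_derive_family (v : V * R) : loc_zero_beyond O ('D_v g).
Proof.
apply: loc_zero_beyond_eq (loc_zero_beyond_derive v ga) => // p Pp.
rewrite deriveB//; last exact: smooth_derivable gS Pp.
by rewrite (derive_cst a) subr0.
Qed.

Lemma zero_third (f : V * R -> 'rV[R]_N) : loc_zero_beyond O f ->
  loc_zero_beyond O (fun p => third (g p) (f p)).
Proof.
move=> z; apply: (loc_zero_beyond_mx oO) => i j.
move=> s Os; have [M M0 nM] := z s Os; exists M => //.
apply: filterS nM => t tM x Mx; rewrite mxE big1// => h _.
by rewrite tM// mxE mulr0.
Qed.

Lemma smooth_third_x : smooth_on P third_x.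
Proof. by apply: smooth_third => //; exact: smooth_derive. Qed.

Lemma zero_third_x : loc_zero_beyond O third_x.
Proof. exact/zero_third/zero_derive_family. Qed.

Lemma smooth_cov_flux xi : smooth_on P xi -> smooth_on P (cov_flux xi).
Proof.
move=> S; apply: smooth_mulmx => //; last exact: smooth_third_x.
by apply: smooth_mulmx => //; exact: smooth_cst.
Qed.

Lemma zero_cov_flux xi : loc_zero_beyond O (cov_flux xi).
Proof. by apply: loc_zero_beyond_mulmx; right; exact: zero_third_x. Qed.

Lemma smooth_potential xi : smooth_on P xi -> smooth_on P (potential xi).
Proof.
move=> S; apply: smooth_mulmx => //; last exact: smooth_cst.
apply: smooth_mdx => //; [exact: smooth_cov_flux|exact: zero_cov_flux].
Qed.

Lemma smooth_pencil_vec xi : smooth_on P xi -> smooth_on P (pencil_vec xi).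
Proof.
move=> S; apply: smoothD => //; apply: smoothZ => //.
  by apply: smooth_mulmx => //; [exact: smooth_derive|exact: smooth_cst].
apply: smooth_mulmx => //; last exact: smooth_cst.
by apply: smooth_mulmx => //; [exact: smooth_potential|exact: smooth_third_x].
Qed.

Lemma zero_pencil_vec xi : ends O 1 xi -> loc_zero_beyond O (pencil_vec xi).
Proof.
move=> E; apply: loc_zero_beyondD; apply: loc_zero_beyondZ.
  by apply: loc_zero_beyond_mulmx; left; exact: loc_zero_beyond_dX E.
apply: loc_zero_beyond_mulmx; left; apply: loc_zero_beyond_mulmx; right.
exact: zero_third_x.
Qed.

Lemma smooth_var_term xi zeta : smooth_on P xi -> smooth_on P zeta ->
  smooth_on P (var_term xi zeta).
Proof.
move=> S S'; apply: smoothB => //; apply: smooth_mulmx => //.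
- by apply: smooth_mulmx => //; [exact: smooth_derive|exact: smooth_cst].
- by apply: smooth_third => //; exact: smooth_potential.
- by apply: smooth_mulmx => //; [exact: smooth_derive|exact: smooth_cst].
- by apply: smooth_third => //; exact: smooth_potential.
Qed.

Lemma zero_var_term xi zeta : ends O 1 xi -> ends O 1 zeta ->
  loc_zero_beyond O (var_term xi zeta).
Proof.
move=> E E'; apply: loc_zero_beyondB; apply: loc_zero_beyond_mulmx; left;
  apply: loc_zero_beyond_mulmx; left.
  exact: loc_zero_beyond_dX E'.
exact: loc_zero_beyond_dX E.
Qed.

(** Moving A to the side of [y] turns the nonlocal term, for a covector [y], into its flux paired
    with the integral of the flux of [zeta]. The products to be integrated by parts become
    visible. *)
Lemma dotp_pencil y zeta p : P p -> dotp y (pencil_vec zeta p) =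
  l1 * dotp (y *m eta) ('D_X zeta p) +
  l2 * dotp (y *m eta *m third_x p *m eta) (mdx (cov_flux zeta) p).
Proof.
move=> Pp; rewrite dotpDr !dotpZr !dotp_etar; congr (_ + _ * _).
rewrite dotpC dotp_mulmx third_sym; last exact: PU.
by rewrite dotpC dotp_etar.
Qed.

Lemma smooth_flux_integral xi : smooth_on P xi -> smooth_on P (mdx (cov_flux xi)).
Proof.
move=> S; apply: smooth_mdx => //; [exact: smooth_cov_flux|exact: zero_cov_flux].
Qed.

Lemma ends_flux_integral xi : smooth_on P xi -> ends O (-1) (mdx (cov_flux xi)).
Proof.
move=> S; apply: ends_mdx => //; [exact: smooth_cov_flux|exact: zero_cov_flux].
Qed.

Lemma derive_flux_integral xi p : smooth_on P xi -> P p ->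
  'D_X (mdx (cov_flux xi)) p = cov_flux xi p.
Proof.
by move=> S Pp; apply: derive_mdx2 Pp; [|exact: smooth_cov_flux|exact: zero_cov_flux].
Qed.

Lemma smooth_mulmxr m n q (f : V * R -> 'M[R]_(m, n)) (C : 'M[R]_(n, q)) :
  smooth_on P f -> smooth_on P (fun p => f p *m C).
Proof. by move=> S; apply: smooth_mulmx => //; exact: smooth_cst. Qed.

Lemma derive_lincomb (r1 r2 : R) (f h : V * R -> R) p (v : V * R) :
  derivable f p v -> derivable h p v ->
  'D_v (fun q => r1 * f q + r2 * h q) p = r1 * 'D_v f p + r2 * 'D_v h p.
Proof.
move=> df dh.
rewrite -[fun q => _]/(r1 *: f + r2 *: h).
have d1 : derivable (r1 *: f) p v by exact: derivableZ.
have d2 : derivable (r2 *: h) p v by exact: derivableZ.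
by rewrite (deriveD d1 d2) (@deriveZ _ _ _ f r1 p v df) (@deriveZ _ _ _ h r2 p v dh).
Qed.

Lemma cont_compact_dotp_pencil xi zeta s : smooth_on P xi -> covector_family zeta -> O s ->
  cont_compact (fun r => dotp (xi (s, r)) (pencil_vec zeta (s, r))).
Proof.
move=> xS [zS zE] Os.
apply: (@slice_cont_compact _ _ O (fun p => dotp (xi p) (pencil_vec zeta p))) => //.
  by apply: smooth_dotp => //; exact: smooth_pencil_vec.
by apply: loc_zero_beyond_dotp; right; exact: zero_pencil_vec.
Qed.

(** The sum of the two integrands is the x-derivative of [l1 * S1 + l2 * S2], where [S1] pairs the
    covectors and [S2] the integrals of their fluxes. *)
Lemma pencil_skew xi zeta s : covector_family xi -> covector_family zeta -> O s ->
  pint setT (fun p => dotp (xi p) (pencil_vec zeta p)) s =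
  - pint setT (fun p => dotp (zeta p) (pencil_vec xi p)) s.
Proof.
move=> cx cz Os; have [xS xE] := cx; have [zS zE] := cz.
pose S1 p := dotp (xi p *m eta) (zeta p).
pose S2 p := dotp (mdx (cov_flux xi) p *m eta) (mdx (cov_flux zeta) p).
have mxS := smooth_flux_integral xS; have mzS := smooth_flux_integral zS.
have S1S : smooth_on P S1 by apply: smooth_dotp => //; exact: smooth_mulmxr.
have S2S : smooth_on P S2 by apply: smooth_dotp => //; exact: smooth_mulmxr.
have SS : smooth_on P (fun p => l1 * S1 p + l2 * S2 p).
  by apply: smoothD => //; exact: (smoothZ oP).
have SE : ends O 1 (fun p => l1 * S1 p + l2 * S2 p).
  apply: (endsD (f := fun p => l1 * S1 p)); apply: endsZ.
    by rewrite -(mulr1 1); apply: ends_dotp => //; exact: ends_mulmxr.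
  (* Both integrals of fluxes change sign between the ends, so their product has equal end
     values. *)
  have -> : 1 = -1 * -1 :> R by rewrite mulrNN mulr1.
  by apply: ends_dotp; [apply: ends_mulmxr|]; exact: ends_flux_integral.
apply/eqP; rewrite -addr_eq0 -RintegralD_compact//; last 2 first.
- exact: cont_compact_dotp_pencil.
- exact: cont_compact_dotp_pencil.
rewrite -(pint_dX_eq0 SS SE Os); apply/eqP/eq_Rintegral => x _.
have Pp : P (s, x) by [].
rewrite !dotp_pencil//= derive_lincomb; last 2 first.
- exact: smooth_derivable S1S Pp.
- exact: smooth_derivable S2S Pp.
rewrite !derive_dotp; last 4 first.
- exact: smooth_derivable (smooth_mulmxr _ mxS) Pp.
- exact: smooth_derivable mzS Pp.
- exact: smooth_derivable (smooth_mulmxr _ xS) Pp.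
- exact: smooth_derivable zS Pp.
rewrite !derive_mulmxr; last 2 first.
- exact: smooth_derivable mxS Pp.
- exact: smooth_derivable xS Pp.
rewrite (derive_flux_integral xS Pp) (derive_flux_integral zS Pp).
rewrite [dotp (zeta _ *m eta) _]dotp_eta.
rewrite [dotp (cov_flux zeta _ *m eta) _]dotp_eta.
by ring.
Qed.

(** A is the x-derivative of the Hessian along the family, so its variation is again an x-derivative
    and can be integrated by parts. *)
Lemma derive_third_x p e : P p ->
  'D_(e, 0) third_x p = 'D_X ('D_(e, 0) (fun q => hess (g q))) p.
Proof.
move=> Pp; have HS := smooth_hess oP PU gS.
transitivity ('D_(e, 0) ('D_X (fun q => hess (g q))) p).
  apply: near_eq_derive.
  apply: filterS (open_nbhs_nbhs (conj oP Pp)) => q Pq.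
  by apply/esym; apply: (derive_hess oP PU gS).
exact: smooth_derive_commute_mx HS Pp.
Qed.

Lemma derive_cov_flux xi p e : smooth_on P xi -> P p ->
  'D_(e, 0) (cov_flux xi) p = 'D_(e, 0) xi p *m eta *m third_x p +
    xi p *m eta *m 'D_X ('D_(e, 0) (fun q => hess (g q))) p.
Proof.
move=> S Pp; rewrite derive_mulmx; last 2 first.
- exact: smooth_derivable (smooth_mulmxr _ S) Pp.
- exact: smooth_derivable smooth_third_x Pp.
by rewrite derive_mulmxr ?derive_third_x//; exact: smooth_derivable S Pp.
Qed.

(** The two integrands differ by the x-derivative of [S], whose end values are equal; the pointwise
    identity is [variation_identity]. *)
Lemma pencil_variation xi zeta s e : covector_family xi -> covector_family zeta -> O s ->
  pint setT ('D_(e, 0) (fun p => dotp (xi p) (pencil_vec zeta p))) s =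
  pint setT (fun p => dotp ('D_(e, 0) xi p) (pencil_vec zeta p) -
    dotp ('D_(e, 0) zeta p) (pencil_vec xi p) +
    l2 * dotp ('D_(e, 0) g p) (var_term xi zeta p)) s.
Proof.
move=> cx cz Os; have [xS xE] := cx; have [zS zE] := cz.
pose G := 'D_(e, 0) (fun q => hess (g q)).
have HS := smooth_hess oP PU gS.
have GS : smooth_on P G by exact: smooth_derive.
have GE q : P q -> G q = third (g q) ('D_(e, 0) g q) by move=> Pq; apply: (derive_hess oP PU gS).
have Gz : loc_zero_beyond O G.
  apply: loc_zero_beyond_eq (zero_third (zero_derive_family (e, 0))) => // q Pq.
  by rewrite GE.
pose md := mdx ('D_(e, 0) (cov_flux zeta)).
have fzS := smooth_cov_flux zS; have fxS := smooth_cov_flux xS.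
have dfS := smooth_derive (e, 0) fzS.
have dfz := loc_zero_beyond_derive (e, 0) (zero_cov_flux zeta).
have mdS : smooth_on P md by exact: smooth_mdx.
have mdE : ends O (-1) md by exact: ends_mdx.
have mxS := smooth_flux_integral xS; have mzS := smooth_flux_integral zS.
have mxE := ends_flux_integral xS; have mzE := ends_flux_integral zS.
have xdS := smooth_derive (e, 0) xS; have zdS := smooth_derive (e, 0) zS.
have zdE := ends_derive1 oO e zS zE.
pose S1 p := dotp (xi p *m eta) ('D_(e, 0) zeta p).
pose S2 p := dotp (mdx (cov_flux xi) p *m eta) (md p).
pose S3 p := dotp (xi p *m eta *m G p) (mdx (cov_flux zeta) p *m eta).
pose S4 p := dotp (zeta p *m eta *m G p) (mdx (cov_flux xi) p *m eta).
have xGS : smooth_on P (fun p => xi p *m eta *m G p).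
  by apply: smooth_mulmx => //; exact: smooth_mulmxr.
have zGS : smooth_on P (fun p => zeta p *m eta *m G p).
  by apply: smooth_mulmx => //; exact: smooth_mulmxr.
have S1S : smooth_on P S1 by apply: smooth_dotp => //; exact: smooth_mulmxr.
have S2S : smooth_on P S2 by apply: smooth_dotp => //; exact: smooth_mulmxr.
have S3S : smooth_on P S3 by apply: smooth_dotp => //; exact: smooth_mulmxr.
have S4S : smooth_on P S4 by apply: smooth_dotp => //; exact: smooth_mulmxr.
(* The coefficients 1 and -1 give each sum the shape required by [derive_lincomb]. *)
pose S23 p := 1 * S2 p + 1 * S3 p.
pose S234 p := 1 * S23 p + -1 * S4 p.
pose S p := l1 * S1 p + l2 * S234 p.
have S23S : smooth_on P S23 by apply: smoothD => //; exact: (smoothZ oP).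
have S234S : smooth_on P S234.
  by apply: smoothD => //; exact: (smoothZ oP).
have SS : smooth_on P S by apply: smoothD => //; exact: (smoothZ oP).
(* [S3] and [S4] contain only one integral of a flux, but their factor [G] vanishes near both
   ends. *)
have S34E (f : V * R -> 'rV[R]_N) (h : V * R -> 'rV[R]_N) :
    ends O 1 (fun p => dotp (f p *m eta *m G p) (h p)).
  apply: ends_zero; apply: loc_zero_beyond_dotp; left.
  by apply: loc_zero_beyond_mulmx; right.
have SE : ends O 1 S.
  apply: (endsD (f := fun p => l1 * S1 p)); apply: endsZ.
    by rewrite -(mulr1 1); apply: ends_dotp => //; exact: ends_mulmxr.
  apply: (endsD (f := fun p => 1 * S23 p)); apply: endsZ; last exact: S34E.
  apply: (endsD (f := fun p => 1 * S2 p)); apply: endsZ; last exact: S34E.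
  have -> : 1 = -1 * -1 :> R by rewrite mulrNN mulr1.
  by apply: ends_dotp => //; exact: ends_mulmxr.
pose tau p := dotp ('D_(e, 0) xi p) (pencil_vec zeta p) -
  dotp ('D_(e, 0) zeta p) (pencil_vec xi p) + l2 * dotp ('D_(e, 0) g p) (var_term xi zeta p).
have gdS := smooth_derive (e, 0) gS.
have tauc : cont_compact (fun r => tau (s, r)).
  apply: (@slice_cont_compact _ _ O) => //.
    apply: smoothD => //; last first.
      apply: (smoothZ oP); apply: smooth_dotp => //; exact: smooth_var_term.
    by apply: smoothB => //; apply: smooth_dotp => //; exact: smooth_pencil_vec.
  apply: loc_zero_beyondD.
    apply: loc_zero_beyondB; apply: loc_zero_beyond_dotp; right; exact: zero_pencil_vec.
  by apply: loc_zero_beyondZ; apply: loc_zero_beyond_dotp; right; exact: zero_var_term.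
have DSc : cont_compact (fun r => 'D_X S (s, r)).
  apply: (@slice_cont_compact _ _ O ('D_X S)) => //; first exact: smooth_derive.
  exact: loc_zero_beyond_dX SE.
rewrite -[RHS]addr0 -[X in _ + X](pint_dX_eq0 SS SE Os).
rewrite -RintegralD_compact//; apply: eq_Rintegral => x _.
have Pp : P (s, x) by [].
move: (s, x) Pp => p Pp; rewrite -/(tau p).
have sd (W : normedModType R) (f : V * R -> W) (w : V * R) : smooth_on P f -> derivable f p w.
  by move=> fS; exact: smooth_derivable fS Pp.
(* [phiE], [tauE] and [SE'] bring the three integrands into the variables of
   [variation_identity]. *)
have phiE : 'D_(e, 0) (fun p => dotp (xi p) (pencil_vec zeta p)) p =
    l1 * (dotp ('D_(e, 0) xi p *m eta) ('D_X zeta p) +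
          dotp (xi p *m eta) ('D_X ('D_(e, 0) zeta) p)) +
    l2 * (dotp (('D_(e, 0) xi p *m eta *m third_x p + xi p *m eta *m 'D_X G p) *m eta)
            (mdx (cov_flux zeta) p) +
          dotp (xi p *m eta *m third_x p *m eta) (md p)).
  pose S5 p := dotp (xi p *m eta) ('D_X zeta p).
  pose S6 p := dotp (cov_flux xi p *m eta) (mdx (cov_flux zeta) p).
  have zpS := smooth_derive X zS.
  transitivity ('D_(e, 0) (fun q => l1 * S5 q + l2 * S6 q) p).
    apply: near_eq_derive; apply: filterS (open_nbhs_nbhs (conj oP Pp)) => q Pq.
    exact: dotp_pencil.
  rewrite derive_lincomb; last 2 first.
  - by apply/sd/smooth_dotp => //; exact: smooth_mulmxr.
  - by apply/sd/smooth_dotp => //; exact: smooth_mulmxr.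
  rewrite !derive_dotp; try by apply: sd => //; exact: smooth_mulmxr.
  rewrite !derive_mulmxr; try exact: sd.
  rewrite (derive_cov_flux e xS Pp) (smooth_derive_commute_mx X (e, 0) oP zS Pp).
  by rewrite (derive_mdx1 oO e fzS (zero_cov_flux zeta) Pp).
have tauE : tau p =
    l1 * dotp ('D_(e, 0) xi p *m eta) ('D_X zeta p) +
    l2 * dotp ('D_(e, 0) xi p *m eta *m third_x p *m eta) (mdx (cov_flux zeta) p) -
    (l1 * dotp ('D_(e, 0) zeta p *m eta) ('D_X xi p) +
     l2 * dotp ('D_(e, 0) zeta p *m eta *m third_x p *m eta) (mdx (cov_flux xi) p)) +
    l2 * (dotp ('D_X zeta p *m eta *m G p) (mdx (cov_flux xi) p *m eta) -
          dotp ('D_X xi p *m eta *m G p) (mdx (cov_flux zeta) p *m eta)).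
  rewrite /tau (dotp_pencil _ _ Pp) (dotp_pencil _ _ Pp); congr (_ + _ * _).
  (* Total symmetry of the third derivatives exchanges the potential inside [third] with the
     variation of the field, which produces [G]. *)
  rewrite dotpC dotpBl (GE p Pp).
  by congr (_ - _); apply: dotp_third; exact: PU.
have SE' : 'D_X S p =
    l1 * (dotp ('D_X xi p *m eta) ('D_(e, 0) zeta p) +
          dotp (xi p *m eta) ('D_X ('D_(e, 0) zeta) p)) +
    l2 * (dotp (cov_flux xi p *m eta) (md p) +
          dotp (mdx (cov_flux xi) p *m eta) ('D_(e, 0) zeta p *m eta *m third_x p +
            zeta p *m eta *m 'D_X G p) +
         (dotp ('D_X xi p *m eta *m G p + xi p *m eta *m 'D_X G p)
               (mdx (cov_flux zeta) p *m eta) +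
            dotp (xi p *m eta *m G p) (cov_flux zeta p *m eta) -
          (dotp ('D_X zeta p *m eta *m G p + zeta p *m eta *m 'D_X G p)
               (mdx (cov_flux xi) p *m eta) +
            dotp (zeta p *m eta *m G p) (cov_flux xi p *m eta)))).
  have -> : 'D_X S p = l1 * 'D_X S1 p + l2 * 'D_X S234 p.
    by apply: derive_lincomb; exact: sd.
  have -> : 'D_X S234 p = 1 * 'D_X S23 p + -1 * 'D_X S4 p.
    by apply: derive_lincomb; exact: sd.
  have -> : 'D_X S23 p = 1 * 'D_X S2 p + 1 * 'D_X S3 p.
    by apply: derive_lincomb; exact: sd.
  rewrite !derive_dotp; try by apply: sd => //; exact: smooth_mulmxr.
  have xeS := smooth_mulmxr eta xS; have zeS := smooth_mulmxr eta zS.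
  rewrite (derive_mulmx (sd _ _ _ xeS) (sd _ _ _ GS)).
  rewrite (derive_mulmx (sd _ _ _ zeS) (sd _ _ _ GS)).
  rewrite !derive_mulmxr; try exact: sd.
  rewrite (derive_flux_integral xS Pp) (derive_flux_integral zS Pp).
  rewrite (derive_mdx2 oO dfS dfz Pp) (derive_cov_flux e zS Pp).
  by rewrite !mul1r mulN1r -addrA.
rewrite phiE tauE SE'; apply: variation_identity.
- by apply: third_sym; exact: PU.
- by rewrite (GE p Pp); apply: third_sym; exact: PU.
- by rewrite (GE p Pp); exact: third_assoc (PU Pp).
Qed.

Lemma pencil_jacobi xi zeta chi p : P p ->
  dotp (var_term xi zeta p) (pencil_vec chi p) +
  dotp (var_term zeta chi p) (pencil_vec xi p) +
  dotp (var_term chi xi p) (pencil_vec zeta p) = 0.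
Proof. by move=> Pp; apply: third_cyclic; exact: PU. Qed.

End Family.
End ThirdDerivatives.


(** * Smooth linear maps and restriction of domains *)

Section SmoothLinear.
Context {R : realType}.
Implicit Types V W : normedModType R.

Lemma smooth_linear V W (A : set V) (l : V -> W) : open A ->
  linear l -> continuous l -> smooth_on A l.
Proof.
move=> oA linl cl n; apply: (is_Ck_postlin (f := id) (l := l)) => //.
case: n => [|n]; first by move=> x _; exact: cvg_id.
split => [x _|v]; first exact: ex_diff.
by apply: (is_Ck_eq oA _ (is_Ck_cst n A v)) => x _; rewrite derive_id.
Qed.

Lemma smooth_on_subset V W (A B : set V) (f : V -> W) : B `<=` A ->
  smooth_on A f -> smooth_on B f.
Proof.
move=> BA fS n; have := fS n; elim: n f {fS} => [|n IH] f /=.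
  by move=> cf x /BA; exact: cf.
by move=> [df Df]; split => [x /BA|v]; [exact: df|exact/IH/Df].
Qed.

Lemma continuous_map_fst (S T X : topologicalType) (f : S -> T) :
  continuous f -> continuous (fun p : S * X => (f p.1, p.2)).
Proof.
move=> cf [z x] B [[P Q] /= [nP nQ] PQ]; exists (f @^-1` P, Q) => /=.
  by split => //; exact: cf.
by move=> [z' x'] /= [? ?]; exact: PQ.
Qed.

End SmoothLinear.

(** * Families of fields and second variations *)

Section Families.
Context {R : realType} {N : nat}.
Variables (U : set 'rV[R]_N) (a : 'rV[R]_N).
Hypotheses (oU : open U) (Ua : U a).

Definition joint {k} (u : 'rV[R]_k -> R -> 'rV[R]_N) (p : 'rV[R]_k * R) := u p.1 p.2.

Section OneFamily.
Context {k : nat}.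
Notation V := 'rV[R]_k.
Variables (O : set V) (u : V -> R -> 'rV[R]_N).
Hypothesis fu : is_family U a O u.
Notation P := (O `*` [set: R]).

Lemma family_open : open O. Proof. by case: fu. Qed.

Lemma family_smooth : smooth_on P (joint u). Proof. by case: fu. Qed.

Lemma family_val p : P p -> U (joint u p).
Proof. by case: p => s x [Os _]; case: fu => _ _ + _; exact. Qed.

Lemma family_zero : loc_zero_beyond O (fun p => joint u p - a).
Proof.
move=> s Os; case: fu => _ _ _ /(_ s Os)[M nM].
exists (Num.max M 0); first by rewrite le_max lexx orbT.
apply: filterS nM => t tM x; rewrite ge_max => /andP[Mx _].
by rewrite /joint /= tM// subrr.
Qed.

Lemma functional_covector_family (I : functional U a) :
  covector_family O (joint (fun s => vder I (u s))).
Proof.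
split; first exact: vder_smooth fu.
move=> s Os; have [M nM] := vder_const I fu Os.
exists (Num.max M 0); first by rewrite le_max lexx orbT.
apply: filterS nM => t [c tc]; exists c => x; rewrite ge_max => /andP[Mx x0].
by rewrite scale1r /joint /= !tc ?normrN ?ger0_norm.
Qed.

End OneFamily.

(** A single field is treated as a family without parameters, so that the results on families apply
    to it. *)
Lemma constant_family u : is_field U a u -> is_family U a [set: 'rV[R]_0] (fun _ => u).
Proof.
move=> [uS uU [M uM]]; split.
- exact: openT.
- apply: (smooth_prelin (l := snd) (A := setT)) => //.
  by move=> p; exact: cvg_snd.
- by move=> s x _.
- by move=> s _; exists M; exact: filterE.
Qed.

Section Extension.
Context {k : nat}.
Notation V := 'rV[R]_k.
Notation V' := 'rV[R]_(k + 1).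
Variables (O : set V) (u : V -> R -> 'rV[R]_N) (v : V * R -> 'rV[R]_N).
Hypotheses (fu : is_family U a O u).
Notation P := (O `*` [set: R]).
Hypotheses (vS : smooth_on P v) (vz : loc_zero_beyond O v).
Let oO : open O := family_open fu.

(* One more parameter h is added to the family, moving the fields by h v; the
   interior in ext_domain is only there to make the domain open. *)
Definition ext_family (z : V') (x : R) : 'rV[R]_N :=
  u (lsubmx z) x + z 0 (rshift k 0) *: v (lsubmx z, x).

Definition ext_domain : set V' :=
  interior [set z | O (lsubmx z) /\ forall x, U (ext_family z x)].

Let O1 : set V' := [set z | O (lsubmx z)].

Let continuous_lsub : continuous (@lsubmx R 1 k 1).
Proof. exact: continuous_lsubmx. Qed.

Let oO1 : open O1.
Proof. by apply: open_comp => // z _; exact: continuous_lsub. Qed.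

(** Stated on [O1], where the values need not lie in [U]: continuity there is what shows that
    [ext_domain] contains the points with h = 0. *)
Lemma smooth_ext_family1 : smooth_on (O1 `*` [set: R]) (joint ext_family).
Proof.
have oP1 := open_setXT oO1.
pose l (p : V' * R) : V * R := (lsubmx p.1, p.2).
have linl : linear l.
  by move=> r p q; rewrite /l /= linearP.
have cl : continuous l.
  exact: (continuous_map_fst (f := lsubmx)).
have lP p : (O1 `*` [set: R]) p -> P (l p) by move=> [].
have S1 : smooth_on (O1 `*` [set: R]) (fun p => joint u (l p)).
  exact: smooth_prelin linl cl lP (family_smooth fu).
have S2 : smooth_on (O1 `*` [set: R]) (fun p => v (l p)).
  exact: smooth_prelin linl cl lP vS.
have S3 : smooth_on (O1 `*` [set: R]) (fun p : V' * R => p.1 0 (rshift k 0)).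
  apply: smooth_linear => //; first by move=> r p q; rewrite /= !mxE.
  move=> p; apply: (@continuous_comp _ _ _ fst (fun z : V' => z 0 (rshift k 0))).
    exact: cvg_fst.
  exact: coord_continuous.
have S4 : smooth_on (O1 `*` [set: R]) (fun p : V' * R => p.1 0 (rshift k 0) *: v (l p)).
  apply: smooth_mx => // i j.
  apply: (smooth_eq oP1 _ (smoothM oP1 S3 (smooth_coord oP1 i j S2))) => p _.
  by rewrite mxE.
exact: smoothD oP1 _ _ _ S1 S4.
Qed.

(** On a compact segment the values stay in the open set [U] for nearby parameters; beyond it the
    direction vanishes and the field equals [a], a point of [U]. *)
Lemma ext_domain_row s : O s -> ext_domain (row_mx s 0).
Proof.
move=> Os; pose z0 : V' := row_mx s (0 : 'rV[R]_1); rewrite -/z0.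
have lr : lsubmx z0 = s by rewrite row_mxKl.
have zr : z0 0 (rshift k 0) = 0 by rewrite row_mxEr mxE.
move: z0 lr zr => z0 lr zr.
have nl (Q : set V) : (\forall t \near s, Q t) -> \forall z \near z0, Q (lsubmx z).
  by move=> nQ; apply: (continuous_lsub _); rewrite lr.
have [M M0 nM] := family_zero fu Os; have [M' M'0 nM'] := vz Os.
pose K := Num.max M M'.
have cov : \forall z \near z0, forall x,
    `[- K, K]%classic x -> U (ext_family z x).
  have := @segment_compact R (- K) K => /compact_near_coveringP.
  move=> /(_ _ (nbhs (z0)) (fun z x => U (ext_family z x)) _).
  apply => x _.
  have c : {for (z0, x), continuous (joint ext_family)}.
    apply: smooth_continuous smooth_ext_family1 _; split => //=.
    by rewrite /O1 /= lr.
  have Ux : U (joint ext_family (z0, x)).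
    rewrite /joint /ext_family /= lr zr scale0r addr0.
    exact: (family_val fu (p := (s, x))).
  have [[A B] /= [nA nB] AB] := c _ (open_nbhs_nbhs (conj oU Ux)).
  by exists (B, A) => //= -[y z] /= [By Az]; exact: (AB (z, y)).
have nO := nl _ (open_nbhs_nbhs (conj oO Os)).
have nMM : \forall z \near z0, (forall x, M <= `|x| -> joint u (lsubmx z, x) - a = 0) /\
    forall x, M' <= `|x| -> v (lsubmx z, x) = 0.
  by apply: filterI; [exact: (nl _ nM)|exact: (nl _ nM')].
suff : \forall z \near z0,
  O (lsubmx z) /\ forall x, U (ext_family z x) by [].
apply: filterS3 cov nO nMM => z zU Oz [zM zM']; split => // x.
have [xK|/ltW Kx] := leP `|x| K.
  by apply: zU => /=; rewrite in_itv/= -ler_norml.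
move: Kx; rewrite ge_max => /andP[/zM ua /zM' v0].
rewrite /ext_family v0 scaler0 addr0.
by move/eqP: ua; rewrite subr_eq0 => /eqP; rewrite /joint /= => ->.
Qed.

Lemma ext_is_family : is_family U a ext_domain ext_family.
Proof.
have sub : ext_domain `<=` O1 by move=> z /interior_subset[].
split.
- exact: open_interior.
- apply: smooth_on_subset smooth_ext_family1 => -[z x] [/= /sub].
  by [].
- by move=> z x /interior_subset[_]; exact.
- move=> z /sub Oz.
  have [M M0 nM] := family_zero fu Oz; have [M' M'0 nM'] := vz Oz.
  exists (Num.max M M').
  have : \forall w \near z, (forall x, M <= `|x| -> joint u (lsubmx w, x) - a = 0) /\
      (forall x, M' <= `|x| -> v (lsubmx w, x) = 0).
    have nl (Q : set V) : (\forall t \near lsubmx z, Q t) -> \forall w \near z, Q (lsubmx w).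
      by move=> nQ; exact: (continuous_lsub nQ).
    by apply: filterI; [exact: (nl _ nM)|exact: (nl _ nM')].
  apply: filterS => w [wM wM'] x; rewrite ge_max => /andP[/wM ua /wM' v0].
  rewrite /ext_family v0 scaler0 addr0.
  by move/eqP: ua; rewrite subr_eq0 => /eqP; rewrite /joint /= => ->.
Qed.

Let dir_ext : V' := row_mx 0 1%:M.

Lemma ext_family_dir s (h : R) : ext_family (h *: dir_ext + row_mx s 0) =
  fun x => u s x + h *: v (s, x).
Proof.
apply/funext => x; rewrite /ext_family /dir_ext scale_row_mx add_row_mx row_mxKl row_mxEr.
by rewrite scaler0 add0r !mxE eqxx mulr1 addr0.
Qed.

Lemma ext_family_base s t (h : R) : ext_family (h *: row_mx t 0 + row_mx s 0) = u (h *: t + s).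
Proof.
apply/funext => x; rewrite /ext_family scale_row_mx add_row_mx row_mxKl row_mxEr.
by rewrite scaler0 add0r !mxE scale0r addr0.
Qed.

(** The vector I''(y) of the overview, at the field [w]. It is defined for single fields because the
    variational derivative of a bracket has to be a function of the field alone. *)
Definition second_variation (I : functional U a) (w : R -> 'rV[R]_N) (y : R -> 'rV[R]_N)
    (x : R) : 'rV[R]_N :=
  'D_1 (fun h : R => vder I (fun r => w r + h *: y r) x) 0.

Lemma second_variationE I s x : second_variation I (u s) (fun r => v (s, r)) x =
  'D_(dir_ext, 0) (joint (fun z => vder I (ext_family z))) (row_mx s 0, x).
Proof.
apply: derive_line => h.
rewrite /joint -[((h *: _ + _).1)]/(h *: dir_ext + row_mx s 0) ext_family_dir.
rewrite -[_.2]/(h * 0 + x) mulr0 add0r; congr (vder I _ x).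
by apply/funext => r; rewrite addr0 -[h%:A]/(h * 1) mulr1.
Qed.

Lemma derive_ext_base (I : functional U a) s e x : 
  'D_(row_mx e 0, 0) (joint (fun z => vder I (ext_family z))) (row_mx s 0, x) =
  'D_(e, 0) (joint (fun s => vder I (u s))) (s, x).
Proof.
apply: derive_line => h.
rewrite /joint -[((h *: _ + _).1)]/(h *: row_mx e 0 + row_mx s 0) ext_family_base.
by [].
Qed.

Lemma derive_ext_dir s x : 'D_(dir_ext, 0) (joint ext_family) (row_mx s 0, x) = v (s, x).
Proof.
transitivity ('D_1 (fun h : R => u s x + h *: v (s, x)) 0).
  apply: derive_line => h.
  rewrite /joint -[((h *: _ + _).1)]/(h *: dir_ext + row_mx s 0) ext_family_dir.
  rewrite -[_.2]/(h * 0 + x) mulr0 add0r addr0 -[h%:A]/(h * 1) mulr1.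
  by [].
move: (v (s, x)) => w.
have did : differentiable (id : R -> R) 0 by exact: ex_diff.
have dw : differentiable (fun h : R => h *: w) 0 by exact: differentiableZl.
rewrite -[fun h : R => _]/(cst (u s x) + (fun h : R => h *: w)) deriveD; last 2 first.
- exact: derivable_cst.
- exact: diff_derivable.
rewrite derive_cst add0r deriveE// (diffZl w did) diff_val.
by rewrite scale1r.
Qed.

Lemma derive_ext_base_field s e x : 
  'D_(row_mx e 0, 0) (joint ext_family) (row_mx s 0, x) = 'D_(e, 0) (joint u) (s, x).
Proof.
apply: derive_line => h.
rewrite /joint -[((h *: _ + _).1)]/(h *: row_mx e 0 + row_mx s 0) ext_family_base.
by [].
Qed.

Lemma continuous_row_mx0 : continuous (fun s : V => row_mx s (0 : 'rV[R]_1)).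
Proof.
move=> s; apply: (@smooth_continuous _ _ setT) => //.
apply: smooth_mx => [|i j]; first exact: openT.
under eq_fun do rewrite mxE.
case: (fintype.split j) => j' /=.
  apply: (smooth_linear (l := fun s : V => s i j')); first exact: openT.
    by move=> r p q; rewrite !mxE.
  exact: coord_continuous.
by under eq_fun do rewrite mxE; exact: smooth_cst.
Qed.

(** The second variation is the derivative of [vder I] in the added parameter, restricted to h = 0;
    smoothness and end values are inherited from the extended family. *)
Lemma second_variation_family I :
  covector_family O (fun p => second_variation I (u p.1) (fun r => v (p.1, r)) p.2).
Proof.
pose f := 'D_(dir_ext, 0) (joint (fun z => vder I (ext_family z))).
pose l (p : V * R) : V' * R := (row_mx p.1 0, p.2).
have fE : (fun p => second_variation I (u p.1) (fun r => v (p.1, r)) p.2) = (fun p => f (l p)).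
  by apply/funext => -[s x]; rewrite second_variationE.
have [S E] := functional_covector_family ext_is_family I.
rewrite fE; split.
  apply: (smooth_prelin (A := ext_domain `*` [set: R])).
  - move=> r p q; apply: injective_projections => //=.
    by rewrite scale_row_mx add_row_mx scaler0 addr0.
  - exact: (continuous_map_fst (f := fun s : V => row_mx s (0 : 'rV[R]_1)) continuous_row_mx0).
  - by move=> [s x] [Os _]; split => //; exact: ext_domain_row.
  - exact: smooth_derive.
have fE1 := ends_derive1 (open_interior _) dir_ext S E.
move=> s Os; have [M M0 nM] := fE1 _ (ext_domain_row Os).
exists M => //; exact: (continuous_row_mx0 nM).
Qed.

End Extension.
End Families.


(** * Symmetry of the second variation *)

Section SecondVariation.
Context {R : realType} {N : nat}.
Variables (U : set 'rV[R]_N) (a : 'rV[R]_N).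
Hypothesis oU : open U.
Context {k : nat}.
Notation V := 'rV[R]_k.
Variables (O : set V) (u : V -> R -> 'rV[R]_N).
Hypothesis fu : is_family U a O u.
Notation P := (O `*` [set: R]).
Let oO : open O := family_open fu.
Let oP := open_setXT oO.

Lemma eq_pint D (f g : V * R -> R) s :
  (forall p, P p -> f p = g p) -> O s -> pint D f s = pint D g s.
Proof. by move=> fg Os; apply: eq_Rintegral => x _; apply: fg. Qed.

Definition joint_vder (I : functional U a) := joint (fun s => vder I (u s)).

Lemma pint_dotpD (f1 f2 g1 g2 : V * R -> 'rV[R]_N) s :
  cont_compact (fun r => dotp (f1 (s, r)) (g1 (s, r))) ->
  cont_compact (fun r => dotp (f2 (s, r)) (g2 (s, r))) ->
  pint setT (fun p => dotp (f1 p) (g1 p) + dotp (f2 p) (g2 p)) s =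
  pint setT (fun p => dotp (f1 p) (g1 p)) s + pint setT (fun p => dotp (f2 p) (g2 p)) s.
Proof. by move=> c1 c2; rewrite -RintegralD_compact. Qed.

Lemma cont_compact_dotp (f g : V * R -> 'rV[R]_N) s : smooth_on P f -> smooth_on P g ->
  loc_zero_beyond O f \/ loc_zero_beyond O g -> O s ->
  cont_compact (fun r => dotp (f (s, r)) (g (s, r))).
Proof.
move=> fS gS z Os.
apply: (@slice_cont_compact _ _ O (fun p => dotp (f p) (g p))) => //.
  exact: smooth_dotp.
exact: loc_zero_beyond_dotp.
Qed.

Lemma zero_derive_joint (v : V * R) : loc_zero_beyond O ('D_v (joint u)).
Proof. by apply: (zero_derive_family oO (family_smooth fu)); exact: family_zero fu. Qed.

Lemma is_derive_functional (I : functional U a) s e : O s ->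
  is_derive s e (fun t => Defs.val I (u t))
    (pint setT (fun p => dotp (joint_vder I p) ('D_(e, 0) (joint u) p)) s).
Proof.
move=> Os; apply: is_derive_eq (vderP I fu e Os) _.
by apply: eq_Rintegral => x _; rewrite derive_slice1.
Qed.

(** Adding to either side the pairing of [vder I] with the mixed second derivative of the fields
    gives a mixed second derivative of the values of [I]. Both the sums and the added terms are
    symmetric in the two directions. *)
Lemma second_derivative_sym (I : functional U a) s e1 e2 : O s ->
  pint setT (fun p => dotp ('D_(e1, 0) (joint_vder I) p) ('D_(e2, 0) (joint u) p)) s =
  pint setT (fun p => dotp ('D_(e2, 0) (joint_vder I) p) ('D_(e1, 0) (joint u) p)) s.
Proof.
move=> Os; have [xS _] := functional_covector_family fu I.
have gS := family_smooth fu.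
pose F t := Defs.val I (u t).
pose phi e p := dotp (joint_vder I p) ('D_(e, 0) (joint u) p).
have gdS e : smooth_on P ('D_(e, 0) (joint u)) by exact: smooth_derive.
have phiS e : smooth_on P (phi e) by exact: smooth_dotp.
have phiz e : loc_zero_beyond O (phi e).
  by apply: loc_zero_beyond_dotp; right; exact: zero_derive_joint.
have DF e t : O t -> 'D_e F t = pint setT (phi e) t.
  by move=> Ot; have [_ ->] := is_derive_functional I e Ot.
have DFS e : smooth_on O ('D_e F).
  apply: (smooth_eq oO _ (smooth_pint oO measurableT (phiS e) (phiz e))) => t Ot.
  by rewrite DF.
have DDF e e' : 'D_e' ('D_e F) s = pint setT ('D_(e', 0) (phi e)) s.
  transitivity ('D_e' (pint setT (phi e)) s).
    apply: near_eq_derive; apply: filterS (open_nbhs_nbhs (conj oO Os)) => t Ot.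
    exact: DF.
  exact: (derive_pint oO _ measurableT (phiS e) (phiz e) Os).
have C : 'D_e1 ('D_e2 F) s = 'D_e2 ('D_e1 F) s.
  (* [F] is only known to be derivable along every direction, with smooth derivatives; that is
     enough here. *)
  apply: (derive_commute oO Os).
  - move=> t Ot; have [d1 _] := is_derive_functional I e1 Ot.
    by have [d2 _] := is_derive_functional I e2 Ot; split; [exact: d2|exact: d1].
  - by move=> t Ot; split; exact: smooth_derivable (DFS _) Ot.
  - exact: smooth_continuous (smooth_derive _ (DFS _)) Os.
  - exact: smooth_continuous (smooth_derive _ (DFS _)) Os.
have E e e' : pint setT ('D_(e', 0) (phi e)) s =
    pint setT (fun p => dotp ('D_(e', 0) (joint_vder I) p) ('D_(e, 0) (joint u) p)) s +
    pint setT (fun p => dotp (joint_vder I p) ('D_(e', 0) ('D_(e, 0) (joint u)) p)) s.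
  rewrite -pint_dotpD; last 2 first.
  - exact: (cont_compact_dotp (smooth_derive (e', 0) xS) (gdS e)
      (or_intror (zero_derive_joint (e, 0))) Os).
  - exact: (cont_compact_dotp xS (smooth_derive (e', 0) (gdS e))
      (or_intror (loc_zero_beyond_derive (e', 0) (zero_derive_joint (e, 0)))) Os).
  apply: eq_pint Os => p Pp; apply: derive_dotp.
    exact: smooth_derivable xS Pp.
  exact: smooth_derivable (gdS e) Pp.
have {}C := etrans (esym (DDF e2 e1)) (etrans C (DDF e1 e2)).
have {}C := etrans (esym (E e2 e1)) (etrans C (E e1 e2)).
have S : pint setT (fun p => dotp (joint_vder I p) ('D_(e1, 0) ('D_(e2, 0) (joint u)) p)) s =
    pint setT (fun p => dotp (joint_vder I p) ('D_(e2, 0) ('D_(e1, 0) (joint u)) p)) s.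
  apply: eq_pint Os => p Pp.
  exact: (congr1 (dotp (joint_vder I p))
    (smooth_derive_commute_mx (e2, 0) (e1, 0) oP gS Pp)).
have cancel (x y z w : R) : x + z = y + w -> z = w -> x = y.
  by move=> xy zw; move: xy; rewrite zw => /addIr.
exact: cancel C S.
Qed.

End SecondVariation.

Section SecondVariationSymmetry.
Context {R : realType} {N : nat}.
Variables (U : set 'rV[R]_N) (a : 'rV[R]_N).
Hypotheses (oU : open U) (Ua : U a).
Context {k : nat}.
Notation V := 'rV[R]_k.
Variables (O : set V) (u : V -> R -> 'rV[R]_N).
Hypothesis fu : is_family U a O u.
Notation P := (O `*` [set: R]).

(** [second_derivative_sym] for the extended family at h = 0, in the direction [e] and that of the
    added parameter. *)
Lemma second_variation_sym (v : V * R -> 'rV[R]_N) (I : functional U a) s e :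
  smooth_on P v -> loc_zero_beyond O v -> O s ->
  pint setT (fun p => dotp ('D_(e, 0) (joint_vder u I) p) (v p)) s =
  pint setT (fun p => dotp (second_variation I (u p.1) (fun r => v (p.1, r)) p.2)
    ('D_(e, 0) (joint u) p)) s.
Proof.
move=> vS vz Os.
have fe := ext_is_family fu vS vz.
have Oe := ext_domain_row oU Ua fu vS vz Os.
have E := second_derivative_sym fe I (row_mx e 0) (row_mx 0 1%:M) Oe.
apply: (etrans _ (etrans E _)); apply: eq_Rintegral => x _.
  by rewrite derive_ext_base derive_ext_dir.
by rewrite derive_ext_base_field -second_variationE.
Qed.

End SecondVariationSymmetry.

(** Two directions require two extensions: the field is first moved along [v], and
    [second_variation_sym] extends the resulting one-parameter family along [w]. *)
Lemma second_variation_field_sym {R : realType} {N : nat} (U : set 'rV[R]_N) a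
    (I : functional U a) (u v w : R -> 'rV[R]_N) : open U -> U a -> is_field U a u ->
  smooth_on setT v -> (exists M, const_beyond v M 0) ->
  smooth_on setT w -> (exists M, const_beyond w M 0) ->
  pairing (second_variation I u v) w = pairing (second_variation I u w) v.
Proof.
move=> oU Ua fu vS [Mv vM] wS [Mw wM].
have f0 := constant_family fu.
have lift k (f : R -> 'rV[R]_N) (O : set 'rV[R]_k) M : smooth_on setT f -> const_beyond f M 0 ->
    smooth_on (O `*` [set: R]) (fun p : 'rV[R]_k * R => f p.2) /\
    loc_zero_beyond O (fun p : 'rV[R]_k * R => f p.2).
  move=> fS fM; split.
    apply: (smooth_prelin (l := snd) (A := setT)) => //.
    by move=> p; exact: cvg_snd.
  move=> s Os; exists (Num.max M 0); first by rewrite le_max lexx orbT.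
  by apply: filterE => t x; rewrite ge_max => /andP[/fM].
have [vS' vz'] := lift 0%N v setT Mv vS vM.
pose v0 (p : 'rV[R]_0 * R) := v p.2.
have fe : is_family U a (ext_domain U setT (fun _ => u) v0) (ext_family (fun _ => u) v0).
  exact: ext_is_family f0 vS' vz'.
have Oe : ext_domain U setT (fun _ => u) v0 (row_mx 0 0) by exact: (ext_domain_row oU Ua f0 vS' vz').
have [wS' wz'] := lift (0 + 1)%N w (ext_domain U setT (fun _ => u) v0) Mw wS wM.
have E := second_variation_sym oU Ua fe I (row_mx 0 1%:M) wS' wz' Oe.
have ue : ext_family (fun=> u) v0 (row_mx 0 0) = u.
  apply/funext => x; rewrite /ext_family row_mxEr mxE scale0r addr0.
  by [].
transitivity (pint setT (fun p => dotp ('D_(row_mx 0 1%:M, 0)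
    (joint_vder (ext_family (fun=> u) v0) I) p) (w p.2)) (row_mx 0 0)).
  apply: eq_Rintegral => x _.
  by rewrite -(second_variationE (fun=> u) v0 I 0).
apply: (etrans E); apply: eq_Rintegral => x _.
by rewrite ue derive_ext_dir.
Qed.


(** * Dependence on a single slice of a family *)

Section Slices.
Context {R : realType} {N : nat}.
Variables (eta : 'M[R]_N) (Phi : 'rV[R]_N -> R) (l1 l2 : R).

Lemma derive_slice_eq {W : normedModType R} k k' (f : 'rV[R]_k * R -> W)
    (f' : 'rV[R]_k' * R -> W) s s' (x : R) : (forall y, f (s, y) = f' (s', y)) ->
  'D_((0, 1) : 'rV[R]_k * R) f (s, x) = 'D_((0, 1) : 'rV[R]_k' * R) f' (s', x).
Proof.
by move=> ff'; rewrite !derive_slice2; congr ('D_1 _ x); apply/funext.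
Qed.

Lemma mdx_slice k k' (b : 'rV[R]_k * R -> 'rV[R]_N) (b' : 'rV[R]_k' * R -> 'rV[R]_N)
    s s' x : (forall y, b (s, y) = b' (s', y)) -> mdx b (s, x) = mdx b' (s', x).
Proof.
move=> bb'; apply/rowP => i; rewrite [LHS]mxE [RHS]mxE.
have E : (fun y => b (s, y) 0 i) = (fun y => b' (s', y) 0 i).
  by apply/funext => y; rewrite bb'.
exact: (congr1 (fun h => dx_inv h x) E).
Qed.

Section TwoFamilies.
Variables (k k' : nat) (g xi zeta : 'rV[R]_k * R -> 'rV[R]_N)
  (g' xi' zeta' : 'rV[R]_k' * R -> 'rV[R]_N) (s : 'rV[R]_k) (s' : 'rV[R]_k').
Hypotheses (gg : forall y, g (s, y) = g' (s', y)) (xx : forall y, xi (s, y) = xi' (s', y))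
  (zz : forall y, zeta (s, y) = zeta' (s', y)).

Lemma third_x_slice x : third_x Phi g (s, x) = third_x Phi g' (s', x).
Proof. by rewrite /third_x gg (derive_slice_eq x gg). Qed.

Lemma potential_slice (f : 'rV[R]_k * R -> 'rV[R]_N) (f' : 'rV[R]_k' * R -> 'rV[R]_N) x :
  (forall y, f (s, y) = f' (s', y)) ->
  potential eta Phi g f (s, x) = potential eta Phi g' f' (s', x).
Proof.
move=> ff; apply: (congr1 (fun r => r *m eta)); apply: mdx_slice => y.
by rewrite /cov_flux third_x_slice ff.
Qed.

Lemma var_term_slice x :
  var_term eta Phi g xi zeta (s, x) = var_term eta Phi g' xi' zeta' (s', x).
Proof.
rewrite /var_term gg (potential_slice x xx) (potential_slice x zz).
by rewrite (derive_slice_eq x xx) (derive_slice_eq x zz).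
Qed.

End TwoFamilies.
End Slices.

Lemma exchange4 {R : realType} {N : nat} (F : 'I_N -> 'I_N -> 'I_N -> 'I_N -> R) :
  \sum_j \sum_m \sum_n \sum_p F j m n p = \sum_p \sum_m \sum_n \sum_j F j m n p.
Proof.
rewrite exchange_big [RHS]exchange_big; apply: eq_bigr => m _.
rewrite exchange_big [RHS]exchange_big; apply: eq_bigr => n _.
by rewrite exchange_big.
Qed.

(** Regroups the two innermost sums of [nonlocal_op] into the nested form of a matrix product. *)
Lemma sum_distr4 {R : realType} {N : nat} (e1 e2 e3 : R) (B D : 'I_N -> R) :
  \sum_k \sum_h e1 * e2 * e3 * B k * D h =
  (\sum_h e3 * D h) * e1 * (\sum_k B k) * e2.
Proof.
have -> : (\sum_h e3 * D h) * e1 * (\sum_k B k) * e2 =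
    ((\sum_k B k) * (\sum_h e3 * D h)) * (e1 * e2) by ring.
rewrite big_distrlr/= mulr_suml; apply: eq_bigr => k _.
by rewrite mulr_suml; apply: eq_bigr => h _; ring.
Qed.

(** * The operators in matrix form *)

Section Operators.
Context {R : realType} {N : nat}.
Variables (eta : 'M[R]_N) (U : set 'rV[R]_N) (Phi : 'rV[R]_N -> R).
Hypotheses (etaT : eta^T = eta) (oU : open U) (PhiS : smooth_on U Phi).

Section Family.
Context {k : nat}.
Notation V := 'rV[R]_k.
Variables (O : set V) (oO : open O) (g xi : V * R -> 'rV[R]_N) (a : 'rV[R]_N).
Notation P := (O `*` [set: R]).
Hypotheses (PU : forall p, P p -> U (g p)) (gS : smooth_on P g).
Hypothesis ga : loc_zero_beyond O (fun p => g p - a).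
Hypothesis xS : smooth_on P xi.
Variable s : V.
Hypothesis Os : O s.
Let oP := open_setXT oO.
Let X : V * R := (0, 1).
Let u y := g (s, y).
Let zeta y := xi (s, y).

Lemma derive1_slice (f : V * R -> 'rV[R]_N) y :
  'D_X f (s, y) = derive1 (fun z => f (s, z)) y.
Proof. by rewrite derive_slice2 derive1E. Qed.

(** [nonlocal_op] applies [dx_inv] to each of these terms separately, whereas [potential] integrates
    their sum; linearity of [dx_inv] needs continuity and bounded support term by term. *)
Definition flux_part r n h j y : R :=
  partial3 Phi r n h (u y) * derive1 u y 0 h * zeta y 0 j.

Lemma cont_compact_flux_part r n h j : cont_compact (flux_part r n h j).
Proof.
pose f p := partial3 Phi r n h (g p) * 'D_X g p 0 h * xi p 0 j.
have -> : flux_part r n h j = fun y => f (s, y).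
  by apply/funext => y; rewrite /flux_part /f derive1_slice.
have gdS := smooth_derive ((0, 1) : V * R) gS.
have gz : loc_zero_beyond O ('D_X g) by exact: zero_derive_family ga _.
apply: (@slice_cont_compact _ _ O f) => //.
  apply: smoothM => //; last exact: smooth_coord.
  apply: smoothM => //; last exact: smooth_coord.
  by apply: (smooth_comp_rV oP PU gS); do 3 apply: smooth_partial.
move=> t Ot; have [M M0 nM] := gz t Ot; exists M => //.
by apply: filterS nM => t' tM x /tM e; rewrite /f e mxE mulr0 mul0r.
Qed.

Lemma flux_integral_sum x n : mdx (cov_flux eta Phi g xi) (s, x) 0 n =
  \sum_j \sum_r \sum_h eta j r * dx_inv (flux_part r n h j) x.
Proof.
rewrite mxE.
transitivity (dx_inv (fun y => \sum_j \sum_r \sum_h eta j r * flux_part r n h j y) x).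
  congr (dx_inv _ x); apply/funext => y; rewrite !mxE.
  transitivity (\sum_r \sum_j \sum_h eta j r * flux_part r n h j y); last first.
    by rewrite exchange_big.
  apply: eq_bigr => r _; rewrite !mxE mulr_suml; apply: eq_bigr => j _.
  rewrite mulr_sumr; apply: eq_bigr => h _.
  by rewrite /flux_part /u /zeta -derive1_slice; ring.
have cc j r n' h : cont_compact (fun y => eta j r * flux_part r n' h j y).
  exact/cont_compactZ/cont_compact_flux_part.
rewrite dx_inv_sum => [|j]; last first.
  by apply: cont_compact_sum => r; exact: cont_compact_sum.
apply: eq_bigr => j _; rewrite dx_inv_sum => [|r]; last exact: cont_compact_sum.
apply: eq_bigr => r _; rewrite dx_inv_sum => [|h]; last exact: cc.
by apply: eq_bigr => h _; rewrite dx_invZ//; exact: cont_compact_flux_part.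
Qed.

Lemma const_opE x : const_op eta u zeta x = 'D_X xi (s, x) *m eta.
Proof.
apply/rowP => i; rewrite !mxE; apply: eq_bigr => j _.
by rewrite derive1_slice mulrC -[in LHS]etaT mxE.
Qed.

Lemma nonlocal_opE x :
  nonlocal_op eta Phi u zeta x = potential eta Phi g xi (s, x) *m third_x Phi g (s, x) *m eta.
Proof.
apply/rowP => i; rewrite !mxE.
transitivity (\sum_p \sum_m \sum_n \sum_j \sum_r \sum_k \sum_h
    eta m n * eta i p * eta j r * (partial3 Phi p m k (u x) * derive1 u x 0 k)
    * dx_inv (flux_part r n h j) x).
  (* The order p, m, n, j is that of the nested sums in the product of matrices on the right. *)
  exact: (exchange4 (fun j m n p => \sum_r \sum_k \sum_h
    eta m n * eta i p * eta j r * (partial3 Phi p m k (u x) * derive1 u x 0 k)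
    * dx_inv (flux_part r n h j) x)).
apply: eq_bigr => p _; rewrite !mxE mulr_suml; apply: eq_bigr => m _.
rewrite !mxE !mulr_suml; apply: eq_bigr => n _.
rewrite flux_integral_sum !mulr_suml; apply: eq_bigr => j _.
rewrite !mulr_suml; apply: eq_bigr => r _.
have -> : \sum_k0 partial3 Phi m p k0 (g (s, x)) * 'D_X g (s, x) 0 k0 =
    \sum_k partial3 Phi p m k (u x) * derive1 u x 0 k.
  apply: eq_bigr => h _; rewrite derive1_slice.
  have Ug : U (g (s, x)) by exact: PU.
  by rewrite (partial3C12 oU PhiS m p h Ug).
have -> : eta n m = eta m n by rewrite -[in LHS]etaT mxE.
have -> : eta p i = eta i p by rewrite -[in LHS]etaT mxE.
exact: (sum_distr4 (eta m n) (eta i p) (eta j r)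
  (fun k => partial3 Phi p m k (u x) * derive1 u x 0 k)
  (fun h => dx_inv (flux_part r n h j) x)).
Qed.

Lemma L_pencilE l1 l2 x :
  L_pencil eta Phi l1 l2 u zeta x = pencil_vec eta Phi l1 l2 g xi (s, x).
Proof. by rewrite /L_pencil /lin_comb const_opE nonlocal_opE. Qed.

End Family.
End Operators.


(** * The bracket as a functional *)

Section BracketFunctional.
Context {R : realType} {N : nat}.
Variables (eta : 'M[R]_N) (U : set 'rV[R]_N) (Phi : 'rV[R]_N -> R).
Hypotheses (etaT : eta^T = eta) (oU : open U) (PhiS : smooth_on U Phi).
Hypothesis assoc : associativity U eta Phi.
Variables (a : 'rV[R]_N) (Ua : U a) (l1 l2 : R).
Notation pencil := (L_pencil eta Phi l1 l2).

(** The single field is presented as a family without parameters; [var_term_slice] compares it with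
    an arbitrary family. *)
Definition var_op (u xi zeta : R -> 'rV[R]_N) (x : R) : 'rV[R]_N :=
  var_term eta Phi (fun p : 'rV[R]_0 * R => u p.2) (fun p => xi p.2) (fun p => zeta p.2) (0, x).

(* Differentiating the covectors in {I,J} gives the two second variations (by
   self-adjointness of the Hessians and skewness of the pencil); var_op is the
   contribution of the explicit dependence of the operator on u. *)
Definition bracket_vder (I J : functional U a) (u : R -> 'rV[R]_N) (x : R) : 'rV[R]_N :=
  second_variation I u (pencil u (vder J u)) x -
  second_variation J u (pencil u (vder I u)) x + l2 *: var_op u (vder I u) (vder J u) x.

Section OnFamily.
Context {k : nat}.
Notation V := 'rV[R]_k.
Variables (O : set V) (u : V -> R -> 'rV[R]_N).
Hypothesis fu : is_family U a O u.
Notation P := (O `*` [set: R]).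
Let oO : open O := family_open fu.
Let oP := open_setXT oO.
Implicit Types I J K : functional U a.

Definition pencil_vder I := pencil_vec eta Phi l1 l2 (joint u) (joint_vder u I).

Lemma pencil_vderE I s : O s ->
  pencil (u s) (vder I (u s)) = fun y => pencil_vder I (s, y).
Proof.
move=> Os; apply/funext => y.
have [xS _] := functional_covector_family fu I.
exact: (L_pencilE etaT oU PhiS oO (family_val fu) (family_smooth fu) (family_zero fu) xS Os).
Qed.

Lemma smooth_pencil_vder I : smooth_on P (pencil_vder I).
Proof.
have [xS _] := functional_covector_family fu I.
exact: (smooth_pencil_vec eta PhiS l1 l2 oO (family_val fu) (family_smooth fu) (family_zero fu) xS).
Qed.

Lemma zero_pencil_vder I : loc_zero_beyond O (pencil_vder I).
Proof.
have [_ xE] := functional_covector_family fu I.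
exact: (zero_pencil_vec eta Phi l1 l2 oO (family_smooth fu) (family_zero fu) xE).
Qed.

Definition second_term I J (p : V * R) : 'rV[R]_N :=
  second_variation I (u p.1) (fun r => pencil_vder J (p.1, r)) p.2.

Definition joint_var I J := var_term eta Phi (joint u) (joint_vder u I) (joint_vder u J).

Lemma bracket_vderE I J p : P p -> joint (fun s => bracket_vder I J (u s)) p =
  second_term I J p - second_term J I p + l2 *: joint_var I J p.
Proof.
case: p => s x [Os _]; rewrite /joint /bracket_vder /=.
have -> : var_op (u s) (vder I (u s)) (vder J (u s)) x = joint_var I J (s, x).
  exact: var_term_slice.
by rewrite (pencil_vderE J Os) (pencil_vderE I Os).
Qed.

Lemma second_term_family I J : covector_family O (second_term I J).
Proof.
exact: (second_variation_family oU Ua fu (smooth_pencil_vder J) (zero_pencil_vder J) I).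
Qed.

Lemma smooth_joint_var I J : smooth_on P (joint_var I J).
Proof.
have [xS _] := functional_covector_family fu I.
have [zS _] := functional_covector_family fu J.
exact: (smooth_var_term eta PhiS oO (family_val fu) (family_smooth fu) (family_zero fu) xS zS).
Qed.

Lemma zero_joint_var I J : loc_zero_beyond O (joint_var I J).
Proof.
have [_ xE] := functional_covector_family fu I.
have [_ zE] := functional_covector_family fu J.
exact: zero_var_term.
Qed.

Lemma bracket_vder_family I J :
  covector_family O (joint (fun s => bracket_vder I J (u s))).
Proof.
have [S1 E1] := second_term_family I J; have [S2 E2] := second_term_family J I.
pose f p := second_term I J p - second_term J I p + l2 *: joint_var I J p.
have fE p : P p -> f p = joint (fun s => bracket_vder I J (u s)) p.
  by move=> Pp; rewrite bracket_vderE.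
split.
  apply: (smooth_eq oP fE); apply: smoothD => //; first exact: smoothB.
  by apply: smoothZ => //; exact: smooth_joint_var.
apply: (ends_eq oO fE); apply: (endsD (f := fun p => second_term I J p - second_term J I p)).
  exact: endsB.
by apply: ends_zero; apply: loc_zero_beyondZ; exact: zero_joint_var.
Qed.

Lemma bracketE I J s : O s -> bracket pencil I J (u s) =
  pint setT (fun p => dotp (joint_vder u I p) (pencil_vder J p)) s.
Proof. by move=> Os; rewrite /bracket pencil_vderE. Qed.

Lemma pint_lincomb3 (f1 f2 f3 : V * R -> R) s : cont_compact (fun r => f1 (s, r)) ->
  cont_compact (fun r => f2 (s, r)) -> cont_compact (fun r => f3 (s, r)) ->
  pint setT (fun p => f1 p - f2 p + l2 * f3 p) s =
  pint setT f1 s - pint setT f2 s + l2 * pint setT f3 s.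
Proof.
move=> c1 c2 c3; have c2' := cont_compactZ (-1) c2; have c3' := cont_compactZ l2 c3.
rewrite /pint -RintegralZ_compact// -mulN1r -RintegralZ_compact//.
rewrite -RintegralD_compact// -RintegralD_compact//; last exact: cont_compactD.
by apply: eq_Rintegral => x _; rewrite mulN1r.
Qed.

Lemma pint_second_term I J s e : O s ->
  pint setT (fun p => dotp ('D_(e, 0) (joint_vder u I) p) (pencil_vder J p)) s =
  pint setT (fun p => dotp (second_term I J p) ('D_(e, 0) (joint u) p)) s.
Proof.
move=> Os.
exact: (second_variation_sym oU Ua fu I e (smooth_pencil_vder J) (zero_pencil_vder J) Os).
Qed.

Lemma is_derive_bracket I J s e : O s ->
  is_derive s e (fun t => bracket pencil I J (u t))
    (pairing (bracket_vder I J (u s)) (fun x => 'D_e (fun t => u t x) s)).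
Proof.
move=> Os; have cI := functional_covector_family fu I.
have cJ := functional_covector_family fu J.
have [xS xE] := cI; have [zS zE] := cJ.
pose phi p := dotp (joint_vder u I p) (pencil_vder J p).
have phiS : smooth_on P phi by apply: smooth_dotp => //; exact: smooth_pencil_vder.
have phiz : loc_zero_beyond O phi.
  by apply: loc_zero_beyond_dotp; right; exact: zero_pencil_vder.
have d := is_derive_pint oO e measurableT phiS phiz Os.
apply: (@near_eq_is_derive _ _ _ (pint setT phi)).
  apply: filterS (open_nbhs_nbhs (conj oO Os)) => t Ot.
  by rewrite bracketE.
apply: is_derive_eq d _.
apply: (etrans (pencil_variation etaT oU PhiS assoc l1 l2 oO (family_val fu)
  (family_smooth fu) (family_zero fu) e cI cJ Os)).
have gdS : smooth_on P ('D_(e, 0) (joint u)) by exact: smooth_derive (family_smooth fu).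
have gz : loc_zero_beyond O ('D_(e, 0) (joint u)) by exact: (zero_derive_joint fu).
have [S1 _] := second_term_family I J; have [S2 _] := second_term_family J I.
have VS := smooth_joint_var I J.
have PIS := smooth_pencil_vder I; have PJS := smooth_pencil_vder J.
apply: (etrans (pint_lincomb3 _ _ _)).
- apply: (cont_compact_dotp fu (smooth_derive (e, 0) xS) PJS _ Os).
  by right; exact: zero_pencil_vder.
- apply: (cont_compact_dotp fu (smooth_derive (e, 0) zS) PIS _ Os).
  by right; exact: zero_pencil_vder.
- by apply: (cont_compact_dotp fu gdS VS _ Os); left.
have subst2 (x y z w v : R) : x = z -> y = w -> x - y + l2 * v = z - w + l2 * v.
  by move=> -> ->.
(* Symmetry of the second variations frees the variation of the field from inside the derivatives of
   the covectors, so that it becomes the vector paired with [bracket_vder]. *)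
apply: (etrans (subst2 _ _ _ _ _ (pint_second_term I J e Os) (pint_second_term J I e Os))).
apply: (etrans (esym (pint_lincomb3 _ _ _))).
- by apply: (cont_compact_dotp fu S1 gdS _ Os); right.
- by apply: (cont_compact_dotp fu S2 gdS _ Os); right.
- by apply: (cont_compact_dotp fu gdS VS _ Os); left.
apply: eq_Rintegral => x _.
have Pp : P (s, x) by [].
have := bracket_vderE I J Pp; rewrite /joint /= => bE.
rewrite -[RHS]/(dotp (bracket_vder I J (u s) x) ('D_e (fun t => u t x) s)) bE.
rewrite dotpDl dotpZl dotpBl [dotp _ (joint_var I J _)]dotpC.
by rewrite derive_slice1.
Qed.

End OnFamily.

Lemma ends_const_beyond k (O : set 'rV[R]_k) (f : 'rV[R]_k * R -> 'rV[R]_N) s :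
  ends O 1 f -> O s -> exists M, \forall t \near s, exists c,
    const_beyond (fun x => f (t, x)) M c.
Proof.
move=> fE Os; have [M M0 nM] := fE s Os; exists M.
apply: filterS nM => t [c cP]; exists c => x.
have [x0|x0] := leP 0 x; first by rewrite ger0_norm// => /cP[].
rewrite ltr0_norm// => /cP[_]; rewrite opprK => ->.
by rewrite scale1r.
Qed.

(** Left transparent: [represents] then holds by computation, and [bracket_bracket] uses the formula
    for [vder]. *)
Definition bracket_functional (I J : functional U a) : functional U a.
Proof.
refine (@Functional R N U a (bracket pencil I J) (bracket_vder I J) _ _ _).
- by move=> k O u fu; have [S _] := bracket_vder_family fu I J.
- move=> k O u fu s Os; have [_ E] := bracket_vder_family fu I J.
  exact: ends_const_beyond E Os.
- by move=> k O u fu s e Os; exact: (is_derive_bracket fu I J e Os).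
Defined.

Lemma bracket_skew (I J : functional U a) u : is_field U a u ->
  bracket pencil I J u = - bracket pencil J I u.
Proof.
move=> fu; have f0 := constant_family fu.
have O0 : [set: 'rV[R]_0] 0 by [].
rewrite (bracketE f0 I J O0) (bracketE f0 J I O0).
exact: (pencil_skew etaT oU PhiS l1 l2 (family_open f0) (family_val f0) (family_smooth f0)
  (family_zero f0) (functional_covector_family f0 I) (functional_covector_family f0 J) O0).
Qed.

Definition hess_form (I J K : functional U a) (u : R -> 'rV[R]_N) : R :=
  pairing (second_variation I u (pencil u (vder J u))) (pencil u (vder K u)).

(** Values of the pencil on covectors vanish near both ends, so they are admissible directions for
    [second_variation_field_sym]. *)
Lemma hess_form_sym I J K u : is_field U a u -> hess_form I J K u = hess_form I K J u.
Proof.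
move=> fu; have f0 := constant_family fu.
have O0 : [set: 'rV[R]_0] 0 by [].
have pS (L : functional U a) : smooth_on setT (pencil u (vder L u)) /\
    exists M, const_beyond (pencil u (vder L u)) M 0.
  rewrite (pencil_vderE f0 L O0); split; last first.
    have [M _ /nbhs_singleton zM] := zero_pencil_vder f0 L O0.
    by exists M.
  apply: (smooth_prelin (l := fun x : R => (0 : 'rV[R]_0, x)) (A := setT `*` setT)) => //.
  - by move=> r x y; apply: injective_projections => //=; rewrite scaler0 addr0.
  - move=> x B [[A C] /= [nA nC] AC]; apply: filterS nC => y Cy.
    by apply: AC; split => //=; exact: nbhs_singleton.
  - exact: smooth_pencil_vder.
have [JS JM] := pS J; have [KS KM] := pS K.
exact: second_variation_field_sym.
Qed.

Lemma bracket_bracket I J K u : is_field U a u ->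
  bracket pencil (bracket_functional I J) K u =
  hess_form I J K u - hess_form J I K u +
  l2 * pint setT (fun p => dotp (joint_var (fun=> u) I J p) (pencil_vder (fun=> u) K p))
    (0 : 'rV[R]_0).
Proof.
move=> fu; have f0 := constant_family fu.
have O0 : [set: 'rV[R]_0] 0 by [].
have [S1 _] := second_term_family f0 I J; have [S2 _] := second_term_family f0 J I.
have VS := smooth_joint_var f0 I J.
have KS := smooth_pencil_vder f0 K; have Kz := zero_pencil_vder f0 K.
rewrite (bracketE f0 _ K O0).
have -> : hess_form I J K u = pint setT
    (fun p => dotp (second_term (fun=> u) I J p) (pencil_vder (fun=> u) K p)) (0 : 'rV[R]_0).
  by rewrite /hess_form (pencil_vderE f0 J O0) (pencil_vderE f0 K O0).
have -> : hess_form J I K u = pint setT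
    (fun p => dotp (second_term (fun=> u) J I p) (pencil_vder (fun=> u) K p)) (0 : 'rV[R]_0).
  by rewrite /hess_form (pencil_vderE f0 I O0) (pencil_vderE f0 K O0).
apply: (etrans _ (pint_lincomb3 _ _ _)).
- apply: (eq_pint (O := setT)) => // p Pp.
  have := bracket_vderE f0 I J Pp; rewrite /joint_vder => ->.
  by rewrite dotpDl dotpZl dotpBl.
- by apply: (cont_compact_dotp f0 S1 KS _ O0); right.
- by apply: (cont_compact_dotp f0 S2 KS _ O0); right.
- by apply: (cont_compact_dotp f0 VS KS _ O0); right.
Qed.

Lemma bracket_jacobi (I J K : functional U a) u : is_field U a u ->
  bracket pencil (bracket_functional I J) K u +
  bracket pencil (bracket_functional J K) I u +
  bracket pencil (bracket_functional K I) J u = 0.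
Proof.
move=> fu; have f0 := constant_family fu.
have O0 : [set: 'rV[R]_0] 0 by [].
rewrite !bracket_bracket// (hess_form_sym I K J fu) (hess_form_sym J K I fu).
rewrite (hess_form_sym K J I fu).
(* After the symmetry rewrites the six Hessian terms take only three values, each occurring once
   with either sign. *)
have telescope (x y z t1 t2 t3 : R) : t1 + t2 + t3 = 0 ->
    (x - y + l2 * t1) + (y - z + l2 * t2) + (z - x + l2 * t3) = 0.
  by move=> t0; transitivity (l2 * (t1 + t2 + t3)); [ring|rewrite t0 mulr0].
apply: telescope.
have c (I' J' K' : functional U a) : cont_compact
    (fun x => dotp (joint_var (fun=> u) I' J' (0 : 'rV[R]_0, x)) (pencil_vder (fun=> u) K' (0, x))).
  apply: (cont_compact_dotp f0 (smooth_joint_var f0 I' J') (smooth_pencil_vder f0 K') _ O0).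
  by right; exact: zero_pencil_vder.
rewrite /pint -RintegralD_compact// -RintegralD_compact//; last exact: cont_compactD.
transitivity (\int[lebesgue_measure]_(x in [set: R]) (0 : R)); last first.
  by rewrite Rintegral_cst// mul0r.
apply: eq_Rintegral => x _.
by apply: (pencil_jacobi etaT oU PhiS assoc l1 l2 (family_val f0)).
Qed.

End BracketFunctional.

Lemma hamiltonian_pencil {R : realType} {N : nat} (eta : 'M[R]_N) (U : set 'rV[R]_N)
    (Phi : 'rV[R]_N -> R) (l1 l2 : R) : eta^T = eta -> open U -> smooth_on U Phi ->
  associativity U eta Phi -> hamiltonian U (L_pencil eta Phi l1 l2).
Proof.
move=> etaT oU PhiS assoc a Ua; split; first by move=> I J u; exact: bracket_skew.
pose F := bracket_functional etaT oU PhiS assoc Ua l1 l2.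
move=> I J K; exists (F I J), (F J K), (F K I); split => //.
by move=> u; exact: bracket_jacobi.
Qed.


(** * Flatness, hydrodynamic form and compatibility *)

Lemma flat_metric_cst {R : realType} {N : nat} (eta : 'M[R]_N) (U : set 'rV[R]_N) :
  eta^T = eta -> eta \in unitmx -> flat_metric U (fun=> eta).
Proof.
move=> etaT etaU; split => [u _|u _ j s k l]; first by split.
have chr i p q : christoffel (fun=> eta) i p q = fun=> 0.
  apply/funext => v; rewrite /christoffel /partial big1 ?mulr0// => m _.
  by rewrite !derive_cst addr0 subr0 mulr0.
rewrite /riemann big1 => [|p _]; last by rewrite !chr mul0r subr0.
by rewrite !chr /partial !derive_cst subr0 addr0.
Qed.

Lemma hydrodynamic_L_op {R : realType} {N : nat} (eta : 'M[R]_N) (U : set 'rV[R]_N)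
    (Phi : 'rV[R]_N -> R) : eta^T = eta -> eta \in unitmx -> open U -> smooth_on U Phi ->
  hydrodynamic_type U (fun=> eta) (L_op eta Phi).
Proof.
move=> etaT etaU oU PhiS.
(* These are the affinors obtained by raising one index of the third derivatives; the witnesses are
   [L = N], [mu = eta], and [b = 0] since the metric is constant. *)
pose w n u : 'M[R]_N := \matrix_(i, k) \sum_p eta i p * partial3 Phi p n k u.
exists (fun _ _ _ _ => 0), N, eta, w; split => //.
- by split => // i j; exact: smooth_cst.
- by move=> i j k; exact: smooth_cst.
- move=> n i j.
  have S : smooth_on U (fun u => \sum_p eta i p * partial3 Phi p n j u).
    apply: smooth_sum => // p; apply: smoothM => //; first exact: smooth_cst.
    by do 3 apply: smooth_partial.
  by apply: smooth_eq S => // u _; rewrite mxE.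
move=> a u xi x Ua fu [xS [M [c xc]]].
have f0 := constant_family fu.
have O0 : [set: 'rV[R]_0] 0 by [].
have xS' : smooth_on ([set: 'rV[R]_0] `*` [set: R]) (fun p => xi p.2).
  by apply: (smooth_prelin (l := snd) (A := setT)) => // p; exact: cvg_snd.
have cc r n h j : cont_compact
    (fun y => partial3 Phi r n h (u y) * derive1 u y 0 h * xi y 0 j).
  exact: (cont_compact_flux_part PhiS (family_open f0) (family_val f0) (family_smooth f0)
    (family_zero f0) xS' O0 r n h j).
apply/rowP => i; rewrite !mxE -big_split; apply: eq_bigr => j _ /=.
have -> : \sum_(h < N) 0 * derive1 u x 0 h = 0 by rewrite big1// => h _; rewrite mul0r.
rewrite mul0r addr0; apply: (congr1 (fun r => eta i j * derive1 xi x 0 j + r)).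
apply: eq_bigr => m _; apply: eq_bigr => n _.
have -> : dx_inv (fun y => (\sum_s w n (u y) j s * derive1 u y 0 s) * xi y 0 j) x =
    \sum_r \sum_h eta j r *
      dx_inv (fun y => partial3 Phi r n h (u y) * derive1 u y 0 h * xi y 0 j) x.
  transitivity (dx_inv (fun y => \sum_r \sum_h eta j r *
      (partial3 Phi r n h (u y) * derive1 u y 0 h * xi y 0 j)) x).
    apply: (congr1 (fun f => dx_inv f x)); apply/funext => y.
    rewrite exchange_big mulr_suml; apply: eq_bigr => s _.
    rewrite mxE mulr_suml mulr_suml; apply: eq_bigr => r _; ring.
  rewrite dx_inv_sum => [|r]; last first.
    by apply: cont_compact_sum => h; apply: cont_compactZ; exact: cc.
  apply: eq_bigr => r _; rewrite dx_inv_sum => [|h]; last by apply: cont_compactZ; exact: cc.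
  by apply: eq_bigr => h _; apply: dx_invZ; exact: cc.
pose D r h := dx_inv (fun y => partial3 Phi r n h (u y) * derive1 u y 0 h * xi y 0 j) x.
pose B p k := partial3 Phi p m k (u x) * derive1 u x 0 k.
have -> : \sum_k w m (u x) i k * derive1 u x 0 k = \sum_p eta i p * \sum_k B p k.
  transitivity (\sum_p \sum_k eta i p * B p k); last first.
    by apply: eq_bigr => p _; rewrite mulr_sumr.
  rewrite exchange_big; apply: eq_bigr => k _; rewrite mxE mulr_suml.
  by apply: eq_bigr => p _; rewrite /B mulrA.
rewrite mulr_sumr mulr_suml; apply: eq_bigr => p _.
transitivity (\sum_r ((\sum_h eta j r * D r h) * eta m n * (\sum_k B p k) * eta i p)).
  apply: eq_bigr => r _.
  exact: (sum_distr4 (eta m n) (eta i p) (eta j r) (B p) (D r)).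
rewrite [RHS]mulr_sumr; apply: eq_bigr => r _.
rewrite -/(D r).
have ring4 (d e1 b e2 : R) : d * e1 * b * e2 = e1 * (e2 * b) * d by ring.
exact: ring4.
Qed.

(** The pencil is closed under linear combinations, so compatibility of its members follows from
    [hamiltonian_pencil] for arbitrary coefficients. *)
Lemma lin_comb_pencil {R : realType} {N : nat} (eta : 'M[R]_N) (Phi : 'rV[R]_N -> R)
    (alpha beta l1 l2 m1 m2 : R) :
  lin_comb alpha beta (L_pencil eta Phi l1 l2) (L_pencil eta Phi m1 m2) =
  L_pencil eta Phi (alpha * l1 + beta * m1) (alpha * l2 + beta * m2).
Proof.
apply/funext => u; apply/funext => xi; apply/funext => x.
rewrite /L_pencil /lin_comb !scalerDr !scalerA !scalerDl.
by rewrite addrACA.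
Qed.

Lemma L_pencil10 {R : realType} {N : nat} (eta : 'M[R]_N) (Phi : 'rV[R]_N -> R) :
  L_pencil eta Phi 1 0 = const_op eta.
Proof.
apply/funext => u; apply/funext => xi; apply/funext => x.
by rewrite /L_pencil /lin_comb scale1r scale0r addr0.
Qed.

Lemma L_pencil11 {R : realType} {N : nat} (eta : 'M[R]_N) (Phi : 'rV[R]_N -> R) :
  L_pencil eta Phi 1 1 = L_op eta Phi.
Proof.
apply/funext => u; apply/funext => xi; apply/funext => x.
by rewrite /L_pencil /lin_comb !scale1r.
Qed.

Theorem mainTheorem6 (R : realType) (N : nat) (eta : 'M[R]_N)
    (U : set 'rV[R]_N) (Phi : 'rV[R]_N -> R)
    (eta_sym : eta^T = eta) (eta_nondeg : eta \in unitmx)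
    (U_open : open U) (Phi_smooth : smooth_on U Phi)
    (Phi_assoc : associativity U eta Phi) :
  (hydrodynamic_type U (fun _ => eta) (L_op eta Phi) /\
   flat_metric U (fun _ => eta) /\
   hamiltonian U (L_op eta Phi)) /\
  ((forall lambda1 lambda2 : R,
      hamiltonian U (L_pencil eta Phi lambda1 lambda2)) /\
   (forall lambda1 lambda2 mu1 mu2 : R,
      compatible U (L_pencil eta Phi lambda1 lambda2)
                   (L_pencil eta Phi mu1 mu2))) /\
  (hamiltonian U (L_pencil eta Phi 0 1) /\
   L_pencil eta Phi 1 0 = const_op eta /\
   compatible U (L_pencil eta Phi 0 1) (const_op eta)).
Proof.
have H l1 l2 : hamiltonian U (L_pencil eta Phi l1 l2) by exact: hamiltonian_pencil.
have C l1 l2 m1 m2 : compatible U (L_pencil eta Phi l1 l2) (L_pencil eta Phi m1 m2).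
  by split => // alpha beta; rewrite lin_comb_pencil.
split; [|split].
- split; first exact: hydrodynamic_L_op.
  by split; [exact: flat_metric_cst|rewrite -L_pencil11].
- by split.
- by split; [|split; [exact: L_pencil10|rewrite -(L_pencil10 eta Phi)]].
Qed.
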